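(* There is an algorithm that, given a poset $\mathcal{P}=(X,\prec)$ with $|X|=n$ (of arbitrary dimension), computes the jump number of $\mathcal{P}$ in time $O(1.824^n)$.
   Context: A poset $\mathcal{P}=(X,\prec)$ consists of a finite ground set $X$ and an irreflexive, transitive binary relation $\prec$ on $X$. A linear extension of $\mathcal{P}$ is a total order on $X$ containing $\prec$. For a linear extension $x_1<\dots<x_n$, a neighboring pair $(x_i,x_{i+1})$ is a jump if $x_i\not\prec x_{i+1}$. The jump number of $\mathcal{P}$ is the minimum, over all linear extensions of $\mathcal{P}$, of the number of jumps. *)

(* Defs.v *)
From mathcomp Require Import all_boot.

Set Implicit Arguments.
Unset Strict Implicit.
Unset Printing Implicit Defensive.

Section JumpNumber.

Variables (X : finType) (lt : rel X).

Definition strict_order (r : rel X) : Prop := irreflexive r /\ transitive r.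

Definition linear_extension (r : rel X) : Prop :=
  [/\ strict_order r, forall x y, x != y -> r x y || r y x & subrel lt r].

(* [s] lists the ground set as x_1 < ... < x_n in the order [r]. *)
Definition increasing_listing (r : rel X) (s : seq X) : bool :=
  perm_eq s (enum X) && sorted r s.

Definition jumps (s : seq X) : nat :=
  count (fun p => ~~ lt p.1 p.2) (zip s (behead s)).

Definition extension_with_jumps (k : nat) : Prop :=
  exists (r : rel X) (s : seq X),
    [/\ linear_extension r, increasing_listing r s & jumps s = k].

Definition is_jump_number (k : nat) : Prop :=
  extension_with_jumps k /\ forall j, extension_with_jumps j -> k <= j.

End JumpNumber.

(* Algorithms are programs of a random access machine with the logarithmic cost
   criterion of Aho, Hopcroft and Ullman: memory is an unbounded array of
   natural numbers, and every operation is charged the bit lengths of its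
   operands, addresses included. Control flow is structured (conditionals and
   loops instead of jumps), which changes running times by at most a constant
   factor. *)

Definition memory := nat -> nat.

Definition update (m : memory) (a v : nat) : memory :=
  fun b => if b == a then v else m b.

(* [Minus] is truncated subtraction, [Quot] is Euclidean division with value 0 when
   the divisor is 0. [Get e] is the content of the cell whose address is the
   value of [e], so that [Get (Const a)] is direct and [Get (Get e)] indirect
   addressing. *)
Inductive expr : Type :=
| Const of nat
| Get of expr
| Plus of expr & expr
| Minus of expr & expr
| Times of expr & expr
| Quot of expr & expr.

(* [Write e1 e2] writes the value of [e2] into the cell whose address is the
   value of [e1]. The tests of [If] and [While] succeed on nonzero values. *)
Inductive cmd : Type :=
| Skip
| Write of expr & expr
| Seq of cmd & cmd
| If of expr & cmd & cmd
| While of expr & cmd.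

Fixpoint eval (m : memory) (e : expr) : nat :=
  match e with
  | Const k => k
  | Get e1 => m (eval m e1)
  | Plus e1 e2 => eval m e1 + eval m e2
  | Minus e1 e2 => eval m e1 - eval m e2
  | Times e1 e2 => eval m e1 * eval m e2
  | Quot e1 e2 => eval m e1 %/ eval m e2
  end.

(* Length of the binary expansion, with [bitlen 0 = 1]. *)
Definition bitlen (k : nat) : nat := (trunc_log 2 k).+1.

Fixpoint eval_cost (m : memory) (e : expr) : nat :=
  match e with
  | Const k => bitlen k
  | Get e1 => eval_cost m e1 + bitlen (eval m e1) + bitlen (m (eval m e1))
  | Plus e1 e2 | Minus e1 e2 | Times e1 e2 | Quot e1 e2 =>
      eval_cost m e1 + eval_cost m e2 + bitlen (eval m e1) + bitlen (eval m e2)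
  end.

Definition test_cost (m : memory) (e : expr) : nat :=
  eval_cost m e + bitlen (eval m e).

(* [exec c m t m']: started on memory [m], the program [c] halts after time [t]
   with memory [m']. *)
Inductive exec : cmd -> memory -> nat -> memory -> Prop :=
| ExecSkip m : exec Skip m 1 m
| ExecWrite m e1 e2 :
    exec (Write e1 e2) m
      (eval_cost m e1 + eval_cost m e2
         + bitlen (eval m e1) + bitlen (eval m e2))
      (update m (eval m e1) (eval m e2))
| ExecSeq c1 c2 m t1 m1 t2 m2 :
    exec c1 m t1 m1 -> exec c2 m1 t2 m2 -> exec (Seq c1 c2) m (t1 + t2) m2
| ExecIfTrue e c1 c2 m t m' :
    eval m e != 0 -> exec c1 m t m' ->
    exec (If e c1 c2) m (test_cost m e + t) m'
| ExecIfFalse e c1 c2 m t m' :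
    eval m e = 0 -> exec c2 m t m' ->
    exec (If e c1 c2) m (test_cost m e + t) m'
| ExecWhileFalse e c m :
    eval m e = 0 -> exec (While e c) m (test_cost m e) m
| ExecWhileTrue e c m t1 m1 t2 m2 :
    eval m e != 0 -> exec c m t1 m1 -> exec (While e c) m1 t2 m2 ->
    exec (While e c) m (test_cost m e + t1 + t2) m2.

(* Cell 0 holds n = #|X|; cells 1, ..., n^2 hold the 0/1 matrix of [lt], row by
   row; all other cells hold 0. *)
Definition encode (X : finType) (lt : rel X) : memory :=
  fun a => if a is b.+1
           then nth 0 [seq nat_of_bool (lt x y) | x <- enum X, y <- enum X] b
           else #|X|.

(* Main.v *)
Require Import Defs.
From mathcomp Require Import all_boot all_order all_algebra.
From mathcomp Require Import zify ring lra.

Set Implicit Arguments.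
Unset Strict Implicit.
Unset Printing Implicit Defensive.

(* A linear extension with k bonds (neighboring pairs that are not jumps) has
   n - 1 - k jumps. Local search yields a matching of the comparability graph
   with m edges and no augmenting path of length 1 or 3: the unmatched points
   form an antichain, and no pair has its two ends comparable to two different
   unmatched points. In an optimal extension call an unmatched point a starter if
   it has a bond with the next element only, a finisher if with the previous one
   only. Bonds send starters and finishers injectively to pairs, so one of these
   two sets has at most m/2 elements.

   Fix a set T of unmatched points that contains the starters and no finisher.
   Then a dynamic program over the down-sets of the matched points, at most 3^m
   in number, finds the optimum: a point outside T is only ever placed right
   after its last predecessor and one in T right before its first successor, so
   the down-set tells whether it is still available. The remaining unmatched
   points can be inserted afterwards without losing bonds.

   T ranges over the sets of at most m/2 unmatched points and their complements.
   There are n - 2m unmatched points, and weighting a set S by z^|S| with z = 0.821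
   bounds the number of states by (1 + z)^n, because 9 <= z (1 + z)^4. *)

(** * A structured language compiled to the random access machine *)

(** The table keeps a down-set of matched points and a last element, so it does not record which
    unmatched points have been used. A point that could be placed on either side of its neighbors
    might be used twice; fixing T in advance assigns one side to each point.

    The exclusion of augmenting paths of length 3 makes T cheap to guess: different unmatched points
    bonded to the two ends of one pair would form such a path, and a starter and a finisher bonded
    to the same element would be comparable. Longer augmenting paths do no harm, so a plain local
    search is enough.

    The machine charges bit lengths. All cells of the run hold O(n) bits, which costs a linear
    factor; like every polynomial factor it disappears in the gap between 1.821 and 1.824. *)

Fixpoint esize (e : expr) : nat :=
  match e with
  | Const k => bitlen k
  | Get e1 => (esize e1).+1
  | Plus e1 e2 | Minus e1 e2 | Times e1 e2 | Quot e1 e2 =>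
      (esize e1 + esize e2).+1
  end.

Lemma bitlen_le p x : 0 < p -> x < 2 ^ p -> bitlen x <= p.
Proof.
move=> p0 hx; rewrite /bitlen.
case: (posnP x) => [->|x0]; first by rewrite trunc_log0.
by rewrite -(ltn_exp2l _ _ (isT : 1 < 2)) (leq_ltn_trans (trunc_logP _ x0)).
Qed.

Lemma ltn_bitlen k : k < 2 ^ bitlen k.
Proof. exact: trunc_log_ltn. Qed.

Lemma esize_gt0 e : 0 < esize e.
Proof. by case: e. Qed.

(** Sums and products lengthen numbers at most additively, differences and quotients not at all. So
    bit lengths are linear in b, with a factor that depends on the expression alone. *)
Lemma eval_lt (b : nat) m e :
  0 < b -> (forall a, m a < 2 ^ b) -> eval m e < 2 ^ (b * esize e).
Proof.
move=> b0 hm; elim: e => [k|e _|e1 h1 e2 h2|e1 h1 e2 h2|e1 h1 e2 h2|e1 h1 e2 h2] /=.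
- by apply: leq_trans (ltn_bitlen k) _; rewrite leq_exp2l // leq_pmull.
- by apply: leq_trans (hm _) _; rewrite leq_exp2l // leq_pmulr.
- have h : 2 ^ (b * (esize e1 + esize e2)) * 2 <= 2 ^ (b * (esize e1 + esize e2).+1).
    by rewrite -expnSr leq_exp2l //; nia.
  have g1 : 2 ^ (b * esize e1) <= 2 ^ (b * (esize e1 + esize e2)).
    by rewrite leq_exp2l //; nia.
  have g2 : 2 ^ (b * esize e2) <= 2 ^ (b * (esize e1 + esize e2)).
    by rewrite leq_exp2l //; nia.
  lia.
- apply: leq_ltn_trans (leq_subr _ _) _; apply: leq_trans h1 _.
  by rewrite leq_exp2l //; nia.
- apply: leq_trans (_ : 2 ^ (b * esize e1) * 2 ^ (b * esize e2) <= _).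
    by rewrite ltn_mul.
  by rewrite -expnD leq_exp2l //; nia.
- apply: leq_ltn_trans (leq_div _ _) _; apply: leq_trans h1 _.
  by rewrite leq_exp2l //; nia.
Qed.

Section Cost.
Variables (b : nat) (m : memory).
Hypotheses (b0 : 0 < b) (hm : forall a, m a < 2 ^ b).

Lemma bitlen_eval e : bitlen (eval m e) <= b * esize e.
Proof. by apply: bitlen_le; [rewrite muln_gt0 b0 esize_gt0|apply: eval_lt]. Qed.

Lemma eval_cost_le e : eval_cost m e <= b * esize e ^ 2.
Proof.
have binop e1 e2 :
    eval_cost m e1 <= b * esize e1 ^ 2 -> eval_cost m e2 <= b * esize e2 ^ 2 ->
  eval_cost m e1 + eval_cost m e2 + bitlen (eval m e1) + bitlen (eval m e2)
    <= b * (esize e1 + esize e2).+1 ^ 2.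
  by move: (bitlen_eval e1) (bitlen_eval e2); nia.
elim: e => [k|e h|e1 h1 e2 h2|e1 h1 e2 h2|e1 h1 e2 h2|e1 h1 e2 h2];
  try exact: binop.
- rewrite /=; set l := bitlen k; have: 0 < l by []. nia.
- rewrite [eval_cost _ _]/= [esize _]/=.
  have h1 := bitlen_eval e.
  have h2 : bitlen (m (eval m e)) <= b by apply: bitlen_le.
  nia.
Qed.

Lemma test_cost_le e : test_cost m e <= b * (esize e ^ 2 + esize e).
Proof. by move: (eval_cost_le e) (bitlen_eval e); rewrite /test_cost; lia. Qed.

Lemma write_cost_le e1 e2 :
  eval_cost m e1 + eval_cost m e2 + bitlen (eval m e1) + bitlen (eval m e2)
    <= b * ((esize e1 ^ 2 + esize e1) + (esize e2 ^ 2 + esize e2)).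
Proof.
by move: (eval_cost_le e1) (bitlen_eval e1) (eval_cost_le e2) (bitlen_eval e2); lia.
Qed.

End Cost.

(* [TRel] tests the order relation of the input, [TCell j t] reads entry [t] of
   array [j]; scalars are arrays read at index 0. *)
Inductive term : Type :=
| TConst of nat
| TSize
| TRel of term & term
| TCell of nat & term
| TAdd of term & term
| TSub of term & term
| TMul of term & term
| TDiv of term & term
| TMod of term & term
| TEq of term & term
| TMax of term & term.

(* [PFor j t p] runs [p] with the counter [TCell j 0] ranging over 0, ..., t - 1;
   entry 1 of array [j] holds the bound. *)
Inductive prog : Type :=
| PSet of nat & term & term
| PSeq of prog & prog
| PIf of term & prog
| PFor of nat & term & prog.

Definition state := nat -> nat -> nat.

Definition upd (s : state) (j i v : nat) : state :=
  fun j' i' => if (j' == j) && (i' == i) then v else s j' i'.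

Lemma updE s j i v j' i' :
  upd s j i v j' i' = if (j' == j) && (i' == i) then v else s j' i'.
Proof. by []. Qed.

Definition width := 32.

Definition size_expr : expr := Get (Const 0).

(* Array [j] lies beyond the input, interleaved with the other arrays: its entry
   [i] is stored at address n^2 + 1 + (width * i + j). *)
Definition caddr (j : nat) (e : expr) : expr :=
  Plus (Plus (Times size_expr size_expr) (Const 1))
       (Plus (Times (Const width) e) (Const j)).

(** In the case of [TRel] the first two factors are 1 for arguments below n and 0 otherwise: an
    index out of range would read a foreign cell, whereas the relation is false there. Equality and
    maximum rest on truncated subtraction. *)
Fixpoint compile_term (t : term) : expr :=
  match t with
  | TConst k => Const k
  | TSize => size_expr
  | TRel t1 t2 =>
      Times (Times (Minus (Const 1) (Minus (Plus (compile_term t1) (Const 1)) size_expr))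
                   (Minus (Const 1) (Minus (Plus (compile_term t2) (Const 1)) size_expr)))
            (Get (Plus (Const 1) (Plus (Times (compile_term t1) size_expr) (compile_term t2))))
  | TCell j t1 => Get (caddr j (compile_term t1))
  | TAdd t1 t2 => Plus (compile_term t1) (compile_term t2)
  | TSub t1 t2 => Minus (compile_term t1) (compile_term t2)
  | TMul t1 t2 => Times (compile_term t1) (compile_term t2)
  | TDiv t1 t2 => Quot (compile_term t1) (compile_term t2)
  | TMod t1 t2 =>
      Minus (compile_term t1) (Times (Quot (compile_term t1) (compile_term t2)) (compile_term t2))
  | TEq t1 t2 =>
      Minus (Const 1) (Plus (Minus (compile_term t1) (compile_term t2))
                            (Minus (compile_term t2) (compile_term t1)))
  | TMax t1 t2 => Plus (compile_term t1) (Minus (compile_term t2) (compile_term t1))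
  end.

Fixpoint twf (t : term) : bool :=
  match t with
  | TConst _ | TSize => true
  | TCell j t1 => (j < width) && twf t1
  | TRel t1 t2 | TAdd t1 t2 | TSub t1 t2 | TMul t1 t2 | TDiv t1 t2
  | TMod t1 t2 | TEq t1 t2 | TMax t1 t2 => twf t1 && twf t2
  end.

Fixpoint writes (p : prog) : seq nat :=
  match p with
  | PSet j _ _ => [:: j]
  | PSeq p1 p2 => writes p1 ++ writes p2
  | PIf _ p1 => writes p1
  | PFor j _ p1 => j :: writes p1
  end.

Fixpoint pwf (p : prog) : bool :=
  match p with
  | PSet j t1 t2 => [&& j < width, twf t1 & twf t2]
  | PSeq p1 p2 => pwf p1 && pwf p2
  | PIf t p1 => twf t && pwf p1
  | PFor j t p1 => [&& j < width, twf t, j \notin writes p1 & pwf p1]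
  end.

Fixpoint compile (p : prog) : cmd :=
  match p with
  | PSet j t1 t2 => Write (caddr j (compile_term t1)) (compile_term t2)
  | PSeq p1 p2 => Seq (compile p1) (compile p2)
  | PIf t p1 => If (compile_term t) (compile p1) Skip
  | PFor j t p1 =>
      Seq (Write (caddr j (Const 1)) (compile_term t))
     (Seq (Write (caddr j (Const 0)) (Const 0))
          (While (Minus (Get (caddr j (Const 1))) (Get (caddr j (Const 0))))
                 (Seq (compile p1)
                      (Write (caddr j (Const 0))
                             (Plus (Get (caddr j (Const 0))) (Const 1))))))
  end.

Definition wsize (e1 e2 : expr) :=
  (esize e1 ^ 2 + esize e1) + (esize e2 ^ 2 + esize e2).

(** A constant of the program alone: with cells of b bits, one step counted by [psteps] costs the
    machine at most [b * psize p]. *)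
Fixpoint psize (p : prog) : nat :=
  match p with
  | PSet j t1 t2 => wsize (caddr j (compile_term t1)) (compile_term t2)
  | PSeq p1 p2 => psize p1 + psize p2
  | PIf t p1 => (esize (compile_term t) ^ 2 + esize (compile_term t)).+1 + psize p1
  | PFor j t p1 =>
      wsize (caddr j (Const 1)) (compile_term t) + wsize (caddr j (Const 0)) (Const 0) +
      (let e := Minus (Get (caddr j (Const 1))) (Get (caddr j (Const 0))) in
       esize e ^ 2 + esize e) +
      wsize (caddr j (Const 0)) (Plus (Get (caddr j (Const 0))) (Const 1)) +
      psize p1
  end.

(** * Semantics, simulation on the machine, and a program logic with step counts *)

Section Semantics.

Variables (n : nat) (R : rel nat) (b : nat).

Fixpoint teval (s : state) (t : term) : nat :=
  match t with
  | TConst k => k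
  | TSize => n
  | TRel t1 t2 => R (teval s t1) (teval s t2)
  | TCell j t1 => s j (teval s t1)
  | TAdd t1 t2 => teval s t1 + teval s t2
  | TSub t1 t2 => teval s t1 - teval s t2
  | TMul t1 t2 => teval s t1 * teval s t2
  | TDiv t1 t2 => teval s t1 %/ teval s t2
  | TMod t1 t2 => teval s t1 %% teval s t2
  | TEq t1 t2 => teval s t1 == teval s t2
  | TMax t1 t2 => maxn (teval s t1) (teval s t2)
  end.

Definition tick (j : nat) (f : state -> state) (s : state) : state :=
  upd (f s) j 0 (f s j 0).+1.

Definition for_init (j N : nat) (s : state) : state := upd (upd s j 1 N) j 0 0.

Fixpoint prun (p : prog) (s : state) : state :=
  match p with
  | PSet j t1 t2 => upd s j (teval s t1) (teval s t2)
  | PSeq p1 p2 => prun p2 (prun p1 s)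
  | PIf t p1 => if teval s t != 0 then prun p1 s else s
  | PFor j t p1 => iter (teval s t) (tick j (prun p1)) (for_init j (teval s t) s)
  end.

Fixpoint psteps (p : prog) (s : state) : nat :=
  match p with
  | PSet _ _ _ => 1
  | PSeq p1 p2 => psteps p1 s + psteps p2 (prun p1 s)
  | PIf t p1 => if teval s t != 0 then (psteps p1 s).+1 else 1
  | PFor j t p1 =>
      (\sum_(k < teval s t)
        (psteps p1 (iter k (tick j (prun p1)) (for_init j (teval s t) s))).+1).+1
  end.

Fixpoint safe (p : prog) (s : state) : Prop :=
  match p with
  | PSet _ _ t2 => teval s t2 < 2 ^ b
  | PSeq p1 p2 => safe p1 s /\ safe p2 (prun p1 s)
  | PIf t p1 => teval s t != 0 -> safe p1 s
  | PFor j t p1 =>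
      teval s t < 2 ^ b /\
      forall k, k < teval s t ->
        safe p1 (iter k (tick j (prun p1)) (for_init j (teval s t) s))
  end.

Definition sim (m : memory) (s : state) : Prop :=
  [/\ m 0 = n,
      forall x y, x < n -> y < n -> m (1 + (x * n + y)) = R x y,
      forall j i, j < width -> m (n * n + 1 + (width * i + j)) = s j i &
      forall a, m a < 2 ^ b].

Hypothesis Rb : forall x y, R x y -> (x < n) && (y < n).
Hypothesis b0 : 0 < b.

Lemma eval_compile_term m s t : sim m s -> twf t -> eval m (compile_term t) = teval s t.
Proof.
case=> hn hR hs _; elim: t => //=.
- move=> t1 h1 t2 h2 /andP[/h1 -> /h2 ->]; rewrite hn.
  set x := teval s t1; set y := teval s t2.
  case: (ltnP x n) => hx; last first.
    have ->: 1 - (x + 1 - n) = 0 by lia.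
    by case: (R x y) (@Rb x y) => // /(_ isT); rewrite ltnNge hx.
  case: (ltnP y n) => hy; last first.
    have ->: 1 - (y + 1 - n) = 0 by lia.
    by rewrite muln0; case: (R x y) (@Rb x y) => // /(_ isT); rewrite andbC ltnNge hy.
  have ->: x + 1 - n = 0 by lia.
  have ->: y + 1 - n = 0 by lia.
  by rewrite hR // mul1n.
- by move=> j t1 h1 /andP[hj /h1 ->]; rewrite hn hs.
- by move=> t1 h1 t2 h2 /andP[/h1 -> /h2 ->].
- by move=> t1 h1 t2 h2 /andP[/h1 -> /h2 ->].
- by move=> t1 h1 t2 h2 /andP[/h1 -> /h2 ->].
- by move=> t1 h1 t2 h2 /andP[/h1 -> /h2 ->].
- move=> t1 h1 t2 h2 /andP[/h1 -> /h2 ->].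
  by rewrite {1}(divn_eq (teval s t1) (teval s t2)) addKn.
- move=> t1 h1 t2 h2 /andP[/h1 -> /h2 ->].
  by case: eqP => [->|/=]; [rewrite subnn|lia].
- by move=> t1 h1 t2 h2 /andP[/h1 -> /h2 ->]; rewrite maxnE.
Qed.

Lemma sim_write m s j e1 e2 i v :
  sim m s -> j < width -> eval m e1 = i -> eval m e2 = v -> v < 2 ^ b ->
  exists t m', [/\ exec (Write (caddr j e1) e2) m t m',
                   t <= b * wsize (caddr j e1) e2 & sim m' (upd s j i v)].
Proof.
move=> hsim hj h1 h2 hv; have [hn hR hs hb] := hsim.
set w := wsize _ _; have ha : eval m (caddr j e1) = n * n + 1 + (width * i + j).
  by rewrite /= hn h1.
do 2 eexists; split; first exact: ExecWrite.
  exact: write_cost_le.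
rewrite ha h2; split.
- by rewrite /update eqn_leq leqn0 !addn_eq0 /= andbF.
- move=> x y hx hy; rewrite /update ifF ?hR //; apply/eqP.
  have : x * n + n <= n * n by rewrite -mulSnr leq_mul2r hx orbT.
  lia.
- move=> j' i' hj'; rewrite /update eqn_add2l /upd -hs //.
  case: (boolP ((j' == j) && (i' == i))) => [/andP[/eqP -> /eqP ->]|h].
    by rewrite eqxx.
  rewrite ifF //; apply/negP => /eqP e; move/negP: h; apply.
  have e1' : j' = j.
    by move: (congr1 (modn^~ width) e); rewrite !(mulnC width) !modnMDl !modn_small.
  move: e; rewrite e1' eqxx /= => e; apply/eqP; move: e; rewrite /width; lia.
- by move=> a; rewrite /update; case: ifP.
Qed.

Lemma prun_writes p s j i : j \notin writes p -> prun p s j i = s j i.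
Proof.
elim: p s => /= [j' t1 t2|p1 h1 p2 h2|t p1 h1|j' t p1 h1] s.
- by rewrite inE /upd => /negbTE ->.
- by rewrite mem_cat negb_or => /andP[w1 w2]; rewrite h2 // h1.
- by move=> w; case: ifP => // _; rewrite h1.
- rewrite inE negb_or => /andP[/negbTE nj w].
  set s0 := for_init _ _ _; have h0 : s0 j i = s j i by rewrite /s0 /for_init /upd nj.
  by elim: (teval s t) => [|k ih] //=; rewrite /tick /upd nj /= h1.
Qed.

Lemma loop_counter p j N k s :
  j \notin writes p ->
  let s' := iter k (tick j (prun p)) (for_init j N s) in s' j 0 = k /\ s' j 1 = N.
Proof.
move=> w /=; elim: k => [|k [h1 h2]]; first by rewrite /for_init /upd /= !eqxx.
by rewrite /= /tick /upd /= !eqxx /= !prun_writes // h1 h2.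
Qed.

Theorem compile_exec p m s :
  pwf p -> sim m s -> safe p s ->
  exists t m', [/\ exec (compile p) m t m', t <= b * psize p * psteps p s &
                   sim m' (prun p s)].
Proof.
elim: p m s => [j t1 t2|p1 h1 p2 h2|t p1 h1|j t p1 h1] m s /=.
- case/and3P=> hj w1 w2 hs hv.
  have [t [m' [he ht hs']]] := sim_write hs hj (eval_compile_term hs w1) (eval_compile_term hs w2) hv.
  by exists t, m'; rewrite muln1.
- case/andP=> w1 w2 hs [s1 s2].
  have [t1 [m1 [e1 l1 hs1]]] := h1 _ _ w1 hs s1.
  have [t2 [m2 [e2 l2 hs2]]] := h2 _ _ w2 hs1 s2.
  exists (t1 + t2), m2; split=> //; first exact: ExecSeq e1 e2.
  nia.
- case/andP=> wt w1 hs hsafe; have ht := eval_compile_term hs wt.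
  have hb : forall a, m a < 2 ^ b by case: hs.
  have hc := test_cost_le b0 hb (compile_term t).
  case: ifP hsafe => [h /(_ isT) hsafe|/negbFE/eqP h _].
    have [t1 [m1 [e1 l1 hs1]]] := h1 _ _ w1 hs hsafe.
    exists (test_cost m (compile_term t) + t1), m1; split=> //.
      by apply: ExecIfTrue; rewrite // ht.
    nia.
  exists (test_cost m (compile_term t) + 1), m; split=> //.
    by apply: ExecIfFalse; [rewrite ht|apply: ExecSkip].
  nia.
- case/and4P=> hj wt nw w1 hs [hN hsafe].
  set N := teval s t in hN hsafe *.
  have [t1 [m1 [e1 l1 hs1]]] := sim_write (e1 := Const 1) hs hj erefl (eval_compile_term hs wt) hN.
  have [t2 [m2 [e2 l2 hs2]]] := sim_write (e1 := Const 0) (e2 := Const 0) (v := 0) hs1 hj erefl erefl (expn_gt0 2 b).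
  set te := Minus _ _; set c := Seq _ (Write _ _).
  set w3 := esize te ^ 2 + esize te; set w4 := wsize _ (Plus _ _).
  set S := fun k => iter k (tick j (prun p1)) (for_init j N s).
  (* Induction on the number d of iterations left; the additional [b * w3] pays for the last test,
     which fails. *)
  suff main d k m' : d + k = N -> sim m' (S k) ->
     exists t' m'', [/\ exec (While te c) m' t' m'',
       t' <= b * (w3 + w4 + psize p1) * (\sum_(k <= i < N) (psteps p1 (S i)).+1) + b * w3
       & sim m'' (S N)].
    have [t3 [m3 [e3 l3 hs3]]] := main N 0 m2 (addn0 N) hs2.
    exists (t1 + (t2 + t3)), m3; split=> //.
      by apply: ExecSeq e1 _; apply: ExecSeq e2 e3.
    move: l3; rewrite big_mkord.
    set sg := \sum_(i < N) _; set a1 := wsize _ _ in l1 *; set a2 := wsize _ _ in l2 *.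
    nia.
  elim: d k m' => [|d ih] k m' hk hs'.
    have [c0 c1] : S k j 0 = k /\ S k j 1 = N := loop_counter N k s nw.
    have hb : forall a, m' a < 2 ^ b by case: hs'.
    have hte : eval m' te = 0.
      rewrite (eval_compile_term (t := TSub (TCell j (TConst 1)) (TCell j (TConst 0))) hs') /=; last by rewrite hj.
      by rewrite c0 c1 -hk subnn.
    exists (test_cost m' te), m'; split; first exact: ExecWhileFalse.
      by apply: leq_trans (test_cost_le b0 hb te) _; rewrite leq_addl.
    by rewrite -hk.
  have [c0 c1] : S k j 0 = k /\ S k j 1 = N := loop_counter N k s nw.
  have hb : forall a, m' a < 2 ^ b by case: hs'.
  have kN : k < N by lia.
  have hte : eval m' te != 0.
    rewrite (eval_compile_term (t := TSub (TCell j (TConst 1)) (TCell j (TConst 0))) hs') /=; last by rewrite hj.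
    by rewrite c0 c1 subn_eq0 -ltnNge.
  have [t3 [m3 [e3 l3 hs3]]] := h1 _ _ w1 hs' (hsafe k kN).
  have cv : prun p1 (S k) j 0 = k by rewrite prun_writes.
  have hv : eval m3 (Plus (Get (caddr j (Const 0))) (Const 1)) = (prun p1 (S k) j 0).+1.
    rewrite (eval_compile_term (t := TAdd (TCell j (TConst 0)) (TConst 1)) hs3) /= ?hj //.
    by rewrite addn1.
  have hlt : (prun p1 (S k) j 0).+1 < 2 ^ b by rewrite cv; apply: leq_ltn_trans hN.
  have [t4 [m4 [e4 l4 hs4]]] := sim_write (e1 := Const 0) hs3 hj erefl hv hlt.
  have hk' : d + k.+1 = N by lia.
  have [t5 [m5 [e5 l5 hs5]]] := ih k.+1 m4 hk' hs4.
  exists (test_cost m' te + (t3 + t4) + t5), m5; split=> //.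
    by apply: ExecWhileTrue e5 => //; apply: ExecSeq e3 e4.
  rewrite big_ltn //; move: (test_cost_le b0 hb te); rewrite -/w3 => l6.
  rewrite -/w4 in l4.
  set sg := \sum_(_ <= i < _) _ in l5 *; move: l3; set ps := psteps p1 _ => l3.
  nia.
Qed.

(** Total correctness with a budget of T steps. As [prun] is a function, termination needs no
    separate clause. *)
Definition wp (p : prog) (T : nat) (Q : state -> Prop) (s : state) : Prop :=
  [/\ safe p s, psteps p s <= T & Q (prun p s)].

(** Here and in [wp_seq] the frame, that is, all cells of arrays that are not written, is handed to
    the continuation, so that postconditions only mention what a program computes. *)
Lemma wp_weaken p T T' (Q Q' : state -> Prop) s :
  wp p T Q s -> T <= T' ->
  (forall s', (forall j i, j \notin writes p -> s' j i = s j i) -> Q s' -> Q' s') ->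
  wp p T' Q' s.
Proof.
case=> h1 h2 h3 hT hQ; split=> //; first exact: leq_trans hT.
by apply: hQ h3 => j i; apply: prun_writes.
Qed.

Lemma wp_le T p T' (Q : state -> Prop) s : wp p T Q s -> T <= T' -> wp p T' Q s.
Proof. by case=> h1 h2 h3 hT; split=> //; apply: leq_trans hT. Qed.

Lemma wp_seq p1 p2 T1 T2 (Q1 Q : state -> Prop) s :
  wp p1 T1 Q1 s ->
  (forall s', (forall j i, j \notin writes p1 -> s' j i = s j i) -> Q1 s' ->
     wp p2 T2 Q s') ->
  wp (PSeq p1 p2) (T1 + T2) Q s.
Proof.
case=> h1 h2 h3 h;
  have [g1 g2 g3] := h _ (fun j i => prun_writes (p := p1) s (j := j) i) h3.
by split=> //=; apply: leq_add.
Qed.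

Lemma wp_set j t1 t2 (Q : state -> Prop) s :
  teval s t2 < 2 ^ b -> Q (upd s j (teval s t1) (teval s t2)) ->
  wp (PSet j t1 t2) 1 Q s.
Proof. by split. Qed.

Lemma wp_if t p T (Q : state -> Prop) s :
  (teval s t != 0 -> wp p T Q s) -> (teval s t = 0 -> Q s) ->
  wp (PIf t p) T.+1 Q s.
Proof.
move=> h1 h2; case: (boolP (teval s t != 0)) => h; rewrite /wp /= ?h ?(negbTE h).
  by have [g1 g2 g3] := h1 h.
by split=> //; apply: h2; apply/eqP; rewrite -[_ == _]negbK.
Qed.

(* The invariant must not depend on the counter, as it is applied to the state
   before the counter is set and after it is incremented. *)
Lemma wp_for j t p (I : nat -> state -> Prop) T N s :
  j \notin writes p -> teval s t = N -> N < 2 ^ b ->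
  (forall k s', I k s' -> forall i v, I k (upd s' j i v)) ->
  I 0 s ->
  (forall k s', k < N -> s' j 0 = k ->
     (forall j' i, j' \notin j :: writes p -> s' j' i = s j' i) ->
     I k s' -> wp p T (I k.+1) s') ->
  wp (PFor j t p) (N * T.+1).+1 (I N) s.
Proof.
move=> w ht hN hI h0 hstep.
set S := fun k => iter k (tick j (prun p)) (for_init j N s).
have frame k j' i : j' \notin j :: writes p -> S k j' i = s j' i.
  rewrite inE negb_or => /andP[/negbTE nj nw].
  have h1 : S 0 j' i = s j' i by rewrite /S /= /for_init /upd nj.
  by elim: k => [|k ih] //=; rewrite /tick /upd nj /= prun_writes.
have inv k : k <= N -> I k (S k).
  elim: k => [|k ih] hk; first by do 2 apply: (hI).
  have [h1 h2] := loop_counter N k s w.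
  have [_ _ h3] := hstep k (S k) hk h1 (frame k) (ih (ltnW hk)).
  by apply: hI.
have body k : k < N -> wp p T (I k.+1) (S k).
  move=> hk; have [h1 h2] := loop_counter N k s w.
  exact: hstep hk h1 (frame k) (inv k (ltnW hk)).
split=> /=; rewrite ht; last exact: inv.
  by split=> // k hk; have [] := body k hk.
rewrite ltnS; apply: leq_trans (_ : \sum_(k < N) T.+1 <= _).
  by apply: leq_sum => k _; rewrite ltnS; have [] := body k (ltn_ord k).
by rewrite sum_nat_const card_ord.
Qed.

End Semantics.

(** * Linear extensions and bonds *)

Section Sequences.

Variables (n : nat) (R : rel nat).
Hypothesis Rb : forall x y, R x y -> (x < n) && (y < n).
Hypothesis Rirr : irreflexive R.
Hypothesis Rtr : transitive R.

(* [n] stands for a missing predecessor; it is not related to anything. *)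
Definition bonds (s : seq nat) : nat :=
  sumn (pairmap (fun x y => nat_of_bool (R x y)) n s).

Definition lin (s : seq nat) : bool :=
  [&& uniq s, all (gtn n) s & pairwise (fun x y => ~~ R y x) s].

Lemma R_ltl x y : R x y -> x < n. Proof. by case/Rb/andP. Qed.
Lemma R_ltr x y : R x y -> y < n. Proof. by case/Rb/andP. Qed.

Lemma R_asym x y : R x y -> R y x = false.
Proof. by move=> h; apply/negP => /(Rtr h); rewrite Rirr. Qed.

Lemma Rn_l x : R n x = false.
Proof. by apply/negP => /R_ltl; rewrite ltnn. Qed.

Lemma Rn_r x : R x n = false.
Proof. by apply/negP => /R_ltr; rewrite ltnn. Qed.

Lemma bonds_cat s1 s2 :
  bonds (s1 ++ s2) =
  bonds s1 + sumn (pairmap (fun x y => nat_of_bool (R x y)) (last n s1) s2).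
Proof. by rewrite /bonds pairmap_cat sumn_cat. Qed.

Lemma bonds_rcons s x : bonds (rcons s x) = bonds s + R (last n s) x.
Proof. by rewrite -cats1 bonds_cat /= addn0. Qed.

Lemma lin_cat s1 s2 :
  lin (s1 ++ s2) =
  [&& lin s1, lin s2, ~~ has (mem s1) s2 & allrel (fun x y => ~~ R y x) s1 s2].
Proof.
rewrite /lin cat_uniq all_cat pairwise_cat.
by do ![case: (uniq _) => //=|case: (all _ _) => //=|case: (pairwise _ _) => //=
  |case: (has _ _) => //=|case: (allrel _ _ _) => //=].
Qed.

Lemma lin1 x : lin [:: x] = (x < n).
Proof. by rewrite /lin /= !andbT. Qed.

Lemma lin_rcons s x :
  lin (rcons s x) = [&& lin s, x < n, x \notin s & all (fun y => ~~ R x y) s].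
Proof. by rewrite -cats1 lin_cat lin1 /= orbF allrel1r. Qed.

Lemma bonds_lt_size s : bonds s <= (size s).-1.
Proof.
case: s => [|x s] //; rewrite /bonds /= Rn_l add0n.
by elim: s x => //= y s ih x; have := ih y; case: (R x y) => /=; lia.
Qed.

Lemma size_lin s : lin s -> size s <= n.
Proof.
case/and3P=> us /allP hs _; rewrite -[X in _ <= X](size_iota 0).
by apply: uniq_leq_size => // x /hs; rewrite mem_iota.
Qed.

(* Right after its last predecessor, a new element makes a bond that compensates
   for the one it may break. *)
Lemma lin_insert z (s : seq nat) :
  z < n -> z \notin s -> lin s ->
  exists s', [/\ perm_eq s' (z :: s), lin s' & bonds s <= bonds s'].
Proof.
move=> hz zs ls.
(* Without a predecessor in the list, z goes to the front, where there is no bond to break. *)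
have [|np] := boolP (has (R^~ z) s); last first.
  exists (z :: s); split=> //.
    rewrite -cat1s lin_cat lin1 hz ls /=; apply/andP; split.
      by apply/hasPn => y ys; rewrite /= inE; apply/eqP => e; rewrite -e ys in zs.
    rewrite allrel1l; apply/allP => y ys.
    by move/hasPn: np => /(_ y ys).
  by rewrite /bonds; case: s {np zs ls} => //= y s; rewrite !Rn_l; lia.
move=> hs; have [s1 [x [s2 [es xz np]]]] :
  exists (s1 : seq nat) (x : nat) (s2 : seq nat), [/\ s = s1 ++ x :: s2, R x z & ~~ has (R^~ z) s2].
  elim: {zs ls} s hs => //= x s ih.
  have [h _|h] := boolP (has (R^~ z) s).
    have [s1 [y [s2 [-> h1 h2]]]] := ih h.
    by exists (x :: s1), y, s2.
  by rewrite orbF => xz; exists [::], x, s.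
rewrite es in zs ls *; exists (s1 ++ x :: z :: s2); split.
- by apply/permP => p; rewrite /= !count_cat /=; lia.
- have -> : s1 ++ x :: z :: s2 = rcons s1 x ++ [:: z] ++ s2 by rewrite cat_rcons.
  move: ls zs; rewrite -cat_rcons (lin_cat (rcons s1 x) s2) mem_cat mem_rcons inE !negb_or.
  case/and4P=> l1 l2 hd ha /andP[/andP[zx z1] z2].
  rewrite !lin_cat l1 lin1 hz l2 /=.
  have zs1 : z \notin rcons s1 x by rewrite mem_rcons inE negb_or zx.
  have h1 : allrel (fun y z => ~~ R z y) (rcons s1 x) [:: z].
    rewrite allrel1r; apply/allP => y; rewrite mem_rcons inE => /orP[/eqP ->|ys].
      by rewrite (R_asym xz).
    apply/negP => zy; move: l1; rewrite lin_rcons => /and4P[_ _ _ /allP /(_ y ys)].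
    by rewrite (Rtr xz zy).
  apply/and3P; split.
  + apply/andP; split.
      by apply/hasPn => y ys; rewrite /= inE; apply/eqP => e; rewrite -e ys in z2.
    by rewrite allrel1l; apply/allP => y ys; move/hasPn: np => /(_ y ys).
  + by rewrite (negbTE zs1) /=.
  + by rewrite allrel_consr; rewrite allrel1r in h1; rewrite h1.
- rewrite (bonds_cat s1 (x :: s2)) (bonds_cat s1 (x :: z :: s2)) /= !leq_add2l xz.
  by case: s2 {np ls zs es} => //= y s2; case: (R x y) => /=; lia.
Qed.

Lemma lin_complete s :
  lin s -> exists s', [/\ perm_eq s' (iota 0 n), lin s' & bonds s <= bonds s'].
Proof.
move: {2}(n - size s) (erefl (n - size s)) => d; elim: d s => [|d ih] s hd ls.
  exists s; split=> //; have /and3P[us /allP hs _] := ls.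
  have h : {subset s <= iota 0 n} by move=> x /hs; rewrite mem_iota.
  apply: uniq_perm; rewrite ?iota_uniq //.
  by have [] := uniq_min_size us h _; rewrite // size_iota -subn_eq0 hd.
have : ~~ all (mem s) (iota 0 n).
  apply/negP => /allP h;
    have : size (iota 0 n) <= size s by apply: uniq_leq_size (iota_uniq 0 n) _.
  by rewrite size_iota; lia.
case/allPn => z; rewrite mem_iota /= => hz zs.
have [s1 [p1 l1 b1]] := lin_insert hz zs ls.
have [|s2 [p2 l2 b2]] := ih s1 _ l1; first by rewrite (perm_size p1) /=; lia.
by exists s2; split=> //; apply: leq_trans b2.
Qed.

End Sequences.

(** * Transfer between the poset and its numbering *)

Lemma nth_allpairs (S T U : Type) (f : S -> T -> U) (s : seq S) (t : seq T)
    (a : S) (b : T) (c : U) i j :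
  i < size s -> j < size t ->
  nth c [seq f x y | x <- s, y <- t] (i * size t + j) = f (nth a s i) (nth b t j).
Proof.
move=> + hj; elim: s i => //= x s ih [_|i hi]; rewrite nth_cat size_map.
  by rewrite hj (nth_map b).
by rewrite mulSn -addnA ltnNge leq_addr /= addKn ih.
Qed.

Section Transfer.

Variables (X : finType) (lt : rel X).
Hypothesis hlt : strict_order lt.

Local Notation n := #|X|.

Definition rk (x : X) : nat := enum_rank x.

Definition natrel : rel nat := fun i j =>
  [exists x : X, exists y : X, [&& rk x == i, rk y == j & lt x y]].

Lemma rk_inj : injective rk.
Proof. by move=> x y /val_inj /enum_rank_inj. Qed.

Lemma rk_lt x : rk x < n. Proof. exact: ltn_ord. Qed.

Lemma natrel_rk x y : natrel (rk x) (rk y) = lt x y.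
Proof.
apply/existsP/idP => [[x' /existsP[y' /and3P[/eqP /rk_inj -> /eqP /rk_inj ->]]]|h] //.
by exists x; apply/existsP; exists y; rewrite !eqxx.
Qed.

Lemma natrelP i j :
  natrel i j -> exists x y, [/\ i = rk x, j = rk y & lt x y].
Proof. by case/existsP=> x /existsP[y /and3P[/eqP <- /eqP <- h]]; exists x, y. Qed.

Lemma natrel_bound i j : natrel i j -> (i < n) && (j < n).
Proof. by case/natrelP=> x [y [-> -> _]]; rewrite !rk_lt. Qed.

Lemma natrel_irr : irreflexive natrel.
Proof.
move=> i; case h: (natrel i i) => //; have [x [y [-> /rk_inj <-]]] := natrelP h.
by rewrite (hlt.1 x).
Qed.

Lemma natrel_trans : transitive natrel.
Proof.
move=> j i k /natrelP[x [y [-> -> h1]]] /natrelP[y' [z [/rk_inj <- -> h2]]].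
by rewrite natrel_rk; apply: hlt.2 h2.
Qed.

(** Each of the [size t - 1] neighboring pairs is either a bond or a jump; truncated subtraction
    makes this right for the empty list as well. *)
Lemma jumps_bonds (t : seq X) :
  jumps lt t = size t - (bonds n natrel (map rk t)).+1.
Proof.
suff: jumps lt t + (bonds n natrel (map rk t) + (0 < size t)) = size t.
  by case: t => //= x t; lia.
case: t => [|x t] //; rewrite /jumps /bonds /= (Rn_l natrel_bound) /= addn1.
by elim: t x => //= y t ih x; rewrite natrel_rk; have := ih y; case: (lt x y) => /=; lia.
Qed.

Lemma lin_map_rk (t : seq X) :
  lin n natrel (map rk t) = uniq t && pairwise (fun x y => ~~ lt y x) t.
Proof.
rewrite /lin (map_inj_uniq rk_inj) pairwise_map all_map; congr (_ && _).
rewrite (eq_all (a2 := predT)) ?all_predT /=; last by move=> x; rewrite /= rk_lt.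
by apply: eq_pairwise => x y /=; rewrite natrel_rk.
Qed.

Lemma perm_enum (t : seq X) : perm_eq t (enum X) = perm_eq (map rk t) (iota 0 n).
Proof.
have -> : iota 0 n = map rk (enum X).
  have sz : size (enum X) = n by rewrite -cardE.
  apply: (@eq_from_nth _ 0) => [|i]; first by rewrite size_iota size_map sz.
  rewrite size_iota => hi.
  have x := enum_val (Ordinal hi).
  by rewrite nth_iota // (nth_map x) ?sz // -(enum_val_nth x (Ordinal hi)) /rk enum_valK.
apply/idP/idP => [|/(perm_map_inj rk_inj) //]; exact: perm_map.
Qed.

Lemma map_rk_surj (s : seq nat) : all (gtn n) s -> exists t, map rk t = s.
Proof.
elim: s => [|i s ih] /=; first by exists [::].
case/andP=> hi /ih[t <-]; exists (enum_val (Ordinal hi) :: t).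
by rewrite /= /rk enum_valK.
Qed.

Lemma lin_extension_with_jumps s :
  perm_eq s (iota 0 n) -> lin n natrel s ->
  extension_with_jumps lt (n - (bonds n natrel s).+1).
Proof.
move=> ps ls; have /and3P[_ hs _] := ls.
have [t et] := map_rk_surj hs; rewrite -et in ps ls *.
have st : size t = n by rewrite -(size_map rk) (perm_size ps) size_iota.
have pt : perm_eq t (enum X) by rewrite perm_enum.
have mt x : x \in t by rewrite (perm_mem pt) mem_enum.
move: ls; rewrite lin_map_rk => /andP[ut hp].
have index_inj x y : index x t = index y t -> x = y.
  by move=> e; rewrite -(nth_index x (mt x)) e nth_index.
exists (fun x y => index x t < index y t), t; split; last by rewrite jumps_bonds st.
  split; first by split=> [x|y x z]; [rewrite ltnn|apply: ltn_trans].
    by move=> x y; apply: contraNT; rewrite negb_or -!leqNgt -eqn_leq => /eqP/index_inj ->.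
  move=> x y xy; rewrite ltnNge leq_eqVlt negb_or; apply/andP; split.
    apply/negP => /eqP/index_inj exy; by move: xy; rewrite exy (hlt.1 _).
  apply/negP => h; move/(pairwiseP x): hp => /(_ (index y t) (index x t)).
  by rewrite !inE !index_mem !mt !nth_index // xy => /(_ isT isT h).
rewrite /increasing_listing pt; case: t ut {et ps mt hp st pt index_inj} => //= x t ut.
apply/(pathP x) => i hi.
have idx k : k <= size t -> index (nth x (x :: t) k) (x :: t) = k.
  by move=> hk; rewrite index_uniq.
by have := ltnSn i; rewrite -{1}(idx i (ltnW hi)) -{1}(idx i.+1 hi).
Qed.

Lemma extension_lin k :
  extension_with_jumps lt k ->
  exists s, [/\ perm_eq s (iota 0 n), lin n natrel s & k = n - (bonds n natrel s).+1].
Proof.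
case=> r [t [[[rirr rtr] rtot rsub] /andP[pt st] <-]].
exists (map rk t); split; first by rewrite -perm_enum.
  rewrite lin_map_rk (perm_uniq pt) enum_uniq /=.
  rewrite sorted_pairwise // in st; apply: sub_pairwise st => x y xy.
  by apply/negP => /rsub /(rtr _ _ _ xy); rewrite rirr.
by rewrite jumps_bonds (perm_size pt) cardT.
Qed.

(** The hypotheses make [best] one more than the maximal number of bonds, which is the form in which
    the table stores its values. *)
Lemma is_jump_number_best best s :
  perm_eq s (iota 0 n) -> lin n natrel s -> best <= (bonds n natrel s).+1 ->
  (forall s', perm_eq s' (iota 0 n) -> lin n natrel s' ->
     (bonds n natrel s').+1 <= best) ->
  is_jump_number lt (n - best).
Proof.
move=> ps ls hb hmax; split.
  have -> : best = (bonds n natrel s).+1 by apply/eqP; rewrite eqn_leq hb hmax.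
  exact: lin_extension_with_jumps.
move=> j /extension_lin[s' [ps' ls' ->]]; exact: leq_sub2l (hmax _ ps' ls').
Qed.

Lemma encode_rel i j :
  i < n -> j < n -> encode lt (1 + (i * n + j)) = natrel i j.
Proof.
move=> hi hj; rewrite add1n /=.
have [x hx] : exists x, rk x = i by exists (enum_val (Ordinal hi)); rewrite /rk enum_valK.
have [y hy] : exists y, rk y = j by exists (enum_val (Ordinal hj)); rewrite /rk enum_valK.
have sz : size (enum X) = n by rewrite -cardE.
have nthi z : nth z (enum X) (rk z) = z by rewrite /rk nth_enum_rank.
have -> : natrel i j = lt (nth x (enum X) i) (nth y (enum X) j).
  by rewrite -hx -hy !nthi natrel_rk.
rewrite -[in i * n]sz (nth_allpairs _ x y) ?sz //.
Qed.

End Transfer.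

(** * Matchings without short augmenting paths *)

(** No carry occurs, so only digit i changes. *)
Lemma digit_add D i j :
  (D %/ 3 ^ i) %% 3 < 2 ->
  ((D + 3 ^ i) %/ 3 ^ j) %% 3 = (D %/ 3 ^ j) %% 3 + (i == j).
Proof.
move=> h; have p3 k : 0 < 3 ^ k by rewrite expn_gt0.
have [ij|ji|ij] := ltngtP i j; last first.
- by rewrite -ij -{1}[3 ^ i]mul1n divnDMl //; lia.
- rewrite addn0 -(subnK (ltnW ji)) expnD divnDMl //.
  have -> : i - j = (i - j).-1.+1 by lia.
  by rewrite expnS mulnC addnC modnMDl.
- rewrite addn0; have -> : j = i.+1 + (j - i.+1) by lia.
  rewrite expnD !divnMA; congr ((_ %/ _) %% _).
  rewrite expnS mulnC !divnMA -{1}[3 ^ i]mul1n divnDMl //; lia.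
Qed.

Section Matching.

Variables (n : nat) (R : rel nat).
Hypothesis Rb : forall x y, R x y -> (x < n) && (y < n).
Hypothesis Rirr : irreflexive R.
Hypothesis Rtr : transitive R.

Definition related u v := R u v || R v u.

Definition matching (f : nat -> nat) : Prop :=
  forall x, x < n -> [/\ f x < n, f (f x) = x & f x != x -> related x (f x)].

(* With [x = v] this describes an edge between the unmatched points [u] and [v],
   otherwise an augmenting path u, x, f x, v. *)
Definition augmenting (f : nat -> nat) u v x : bool :=
  [&& f u == u, f v == v, u != v, related u x &
      (x == v) || ((f x != x) && related v (f x))].

Definition unaugmentable (f : nat -> nat) : Prop :=
  forall u v x, u < n -> v < n -> x < n -> ~~ augmenting f u v x.

(** For x = v the points x, f x and v coincide, and the first two tests already yield the single
    edge uv; so one definition serves both kinds of augmenting path. *)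
Definition augment (f : nat -> nat) u v x : nat -> nat := fun y =>
  if y == x then u else if y == u then x else
  if y == f x then v else if y == v then f x else f y.

Lemma relatedC u v : related u v = related v u. Proof. exact: orbC. Qed.

Lemma related_irr u : related u u = false. Proof. by rewrite /related Rirr. Qed.

Lemma augment_matching f u v x :
  matching f -> u < n -> v < n -> x < n -> augmenting f u v x ->
  matching (augment f u v x).
Proof.
move=> hf hu hv hx /and5P[/eqP fu /eqP fv uv ux hx'].
have nux : u != x by apply: contraTneq ux => ->; rewrite related_irr.
have [fx ffx _] := hf x hx.
case/orP: hx' => [/eqP xv|/andP[nfx vfx]].
  move=> y hy; rewrite /augment; have [fy ffy cy] := hf y hy.
  subst x; rewrite fv.
  have [->|yv] := eqVneq y v.
    by rewrite (negbTE nux) eqxx; split=> // _; rewrite relatedC.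
  have [->|yu] := eqVneq y u; first by rewrite eqxx; split=> // _.
  have -> : (f y == v) = false by apply: contraNF yv => /eqP e; rewrite -ffy e fv.
  have -> : (f y == u) = false by apply: contraNF yu => /eqP e; rewrite -ffy e fu.
  by [].
have nvx : v != x by apply: contraNneq nfx => <-; rewrite fv.
have nufx : u != f x by apply: contraNneq nux => e; rewrite -ffx -e fu.
have nvfx : v != f x by apply: contraNneq nvx => e; rewrite -ffx -e fv.
have xfx : x != f x by rewrite eq_sym.
move=> y hy; rewrite /augment; have [fy ffy cy] := hf y hy.
have [->|yx] := eqVneq y x.
  by rewrite (negbTE nux) eqxx; split=> // _; rewrite relatedC.
have [->|yu] := eqVneq y u; first by rewrite eqxx; split=> // _.
have [->|yfx] := eqVneq y (f x).
  rewrite (negbTE nvx) [v == u]eq_sym (negbTE uv) (negbTE nvfx) eqxx.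
  by split=> // _; rewrite relatedC.
have [->|yv] := eqVneq y v.
  by rewrite (negbTE nfx) [f x == u]eq_sym (negbTE nufx) eqxx; split.
have -> : (f y == x) = false by apply: contraNF yfx => /eqP <-; rewrite ffy.
have -> : (f y == u) = false by apply: contraNF yu => /eqP e; rewrite -ffy e fu.
have -> : (f y == f x) = false by apply: contraNF yx => /eqP e; rewrite -ffy e ffx.
have -> : (f y == v) = false by apply: contraNF yv => /eqP e; rewrite -ffy e fv.
by [].
Qed.

Definition covered (f : nat -> nat) : nat := count (fun y => f y != y) (iota 0 n).

(** Covered points stay covered and u is new. This is the potential that bounds the local search. *)
Lemma covered_augment f u v x :
  matching f -> u < n -> v < n -> x < n -> augmenting f u v x ->
  covered f < covered (augment f u v x).
Proof.
move=> hf hu hv hx /and5P[/eqP fu /eqP fv uv ux hx'].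
have nux : u != x by apply: contraTneq ux => ->; rewrite related_irr.
have [fx ffx _] := hf x hx.
rewrite /covered -!sum1_count.
rewrite big_mkcond [X in _ < X]big_mkcond /=.
rewrite !(bigD1_seq u) ?iota_uniq ?mem_iota //= fu eqxx /=.
rewrite ifT; last by rewrite /augment (negbTE nux) eqxx eq_sym.
rewrite ltnS; apply: leq_sum => y _; rewrite -[f y != y]/(f y != y).
have [|//] := boolP (f y != y); rewrite /augment.
have [->|yx] := eqVneq y x; first by rewrite nux.
have [->|yu] := eqVneq y u; first by rewrite fu eqxx.
have [->|yfx] := eqVneq y (f x).
  case: hx' => /orP[/eqP ->|/andP[_ h]].
    by rewrite fv fv eqxx.
  by rewrite (_ : v != f x) //; apply: contraTneq h => <-; rewrite related_irr.
have [->|yv] := eqVneq y v; first by rewrite fv eqxx.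
by move=> ->.
Qed.

Lemma covered_le f : covered f <= n.
Proof. by rewrite -[X in _ <= X](size_iota 0) count_size. Qed.

End Matching.

(** * Down-sets and partial extensions *)

Section DynamicProgram.

Variables (n : nat) (R : rel nat).
Hypothesis Rb : forall x y, R x y -> (x < n) && (y < n).
Hypothesis Rirr : irreflexive R.
Hypothesis Rtr : transitive R.

Variable f : nat -> nat.
Hypothesis hf : matching n R f.
Hypothesis hfa : unaugmentable n R f.

Local Notation cmp := (related R).
Local Notation bonds := (bonds n R).
Local Notation lin := (lin n R).

Definition matched x := f x != x.

(** The value that the digit of the pair has to reach before a down-set contains x: 1 for the lower
    element, 2 for the upper one, 0 for unmatched points. *)
Definition role x := if R x (f x) then 1 else if R (f x) x then 2 else 0.

Lemma unmatched_anti u v :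
  ~~ matched u -> ~~ matched v -> R u v = false.
Proof.
rewrite /matched !negbK => /eqP fu /eqP fv; apply/negP => uv.
have /andP[hu hv] := Rb uv.
move: (hfa hu hv hv); rewrite /augmenting fu fv !eqxx /= andbT.
rewrite /related uv /= andbT; case: eqP => // e.
by rewrite e Rirr in uv.
Qed.

Lemma unmatched_pair u v x :
  ~~ matched u -> ~~ matched v -> matched x -> u < n -> v < n -> x < n ->
  cmp u x -> cmp v (f x) -> u = v.
Proof.
rewrite /matched !negbK => /eqP fu /eqP fv mx hu hv hx ux vx; apply/eqP.
move: (hfa hu hv hx); rewrite /augmenting fu fv !eqxx /= ux vx.
by rewrite mx /= orbT andbT negbK.
Qed.

Lemma f_lt x : x < n -> f x < n. Proof. by case/hf. Qed.
Lemma f_K x : x < n -> f (f x) = x. Proof. by case/hf. Qed.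

Lemma matched_f x : x < n -> matched (f x) = matched x.
Proof. by move=> hx; rewrite /matched f_K // eq_sym. Qed.

Lemma role_gt0 x : x < n -> (0 < role x) = matched x.
Proof.
move=> hx; have [_ _ h] := hf hx; rewrite /role /matched.
have [e|ne] := eqVneq (f x) x; first by rewrite e Rirr.
by move: (h ne); rewrite /related => /orP[] -> //; case: ifP.
Qed.

Lemma role_le2 x : role x <= 2.
Proof. by rewrite /role; case: ifP => // _; case: ifP. Qed.

Lemma role_f x : x < n -> matched x -> role (f x) = 3 - role x.
Proof.
move=> hx mx; have [_ _ h] := hf hx; rewrite /role f_K //.
move: (h mx); rewrite /related; have [xf|] := boolP (R x (f x));
  first by rewrite (R_asym Rirr Rtr xf).
by move=> _ /= ->.
Qed.

Definition lowers := [seq x <- iota 0 n | R x (f x)].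
Local Notation m := (size lowers).

Variable q : nat -> nat.
Hypothesis q_f : forall x, x < n -> q (f x) = q x.
Hypothesis q_inj : forall x y, x < n -> y < n -> matched x -> matched y ->
  q x = q y -> y = x \/ y = f x.

(* A down-set of the matched points is coded by a number [D] in base 3: the digit
   of a pair counts its elements in the down-set, the lower one coming first. *)
Definition weight x := if matched x then 3 ^ q x else 0.
Definition digit D x := (D %/ weight x) %% 3.
Definition inside D x := role x <= digit D x.
Lemma insideE D x : inside D x = (role x <= digit D x). Proof. by []. Qed.

(** Unmatched x have role 0 and always count as inside, so an unmatched predecessor never blocks a
    placement. If it has not been placed by then, it is left to the final insertion. *)
Definition preds_in D y := all (fun x => R x y ==> inside D x) (iota 0 n).
Definition succs_out D a := all (fun x => R a x ==> ~~ inside D x) (iota 0 n).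
Definition avail D a := [&& ~~ matched a, preds_in D a & succs_out D a].
(** The equation says that b is the next element of its pair; it fails for unmatched b, whose role
    is 0. *)
Definition addable D b := preds_in D b && ((digit D b).+1 == role b).

Lemma preds_inP D y x : preds_in D y -> R x y -> inside D x.
Proof.
move=> /allP h xy; have := h x; rewrite mem_iota xy /=; apply.
by case/andP: (Rb xy).
Qed.

Lemma succs_outP D a x : succs_out D a -> R a x -> ~~ inside D x.
Proof.
move=> /allP h xy; have := h x; rewrite mem_iota xy /=; apply.
by case/andP: (Rb xy).
Qed.

Lemma digit_lt3 D x : digit D x < 3.
Proof. by rewrite ltn_mod. Qed.

Lemma addable_matched D b : b < n -> addable D b -> matched b.
Proof. by move=> hb /andP[_ /eqP e]; rewrite -role_gt0 // -e. Qed.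

Lemma digitD D b x :
  b < n -> x < n -> matched b -> matched x -> digit D b < 2 ->
  digit (D + weight b) x = digit D x + ((x == b) || (x == f b)).
Proof.
move=> hb hx mb mx; rewrite /digit /weight mb mx => h.
rewrite digit_add //; congr (_ + nat_of_bool _).
apply/eqP/orP => [e|[/eqP ->|/eqP ->]]; rewrite ?q_f //.
by case: (q_inj hb hx mb mx e) => ->; rewrite eqxx; [left|right].
Qed.

Lemma insideD D b x :
  b < n -> x < n -> addable D b -> matched x ->
  inside (D + weight b) x = (x == b) || inside D x.
Proof.
move=> hb hx ab mx; have mb := addable_matched hb ab.
have r2 := role_le2 b.
case/andP: ab => _ /eqP e; rewrite /inside digitD //; last by rewrite -ltnS e.
have [->|nxb] /= := eqVneq x b; first by rewrite addn1 e leqnn.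
have [->|nxf] := eqVneq x (f b); last by rewrite addn0.
have ef : digit D (f b) = digit D b.
  by rewrite /digit /weight matched_f // q_f.
(* With r the role of b, the partner has role 3 - r. Both 3 - r <= r - 1 and 3 - r <= r hold for r =
   2 and fail for r = 1, so the partner keeps its status. *)
rewrite role_f // ef; lia.
Qed.

Lemma addable_notin D b : addable D b -> ~~ inside D b.
Proof. by case/andP=> _ /eqP e; rewrite /inside -e ltnn. Qed.

(** * Soundness of the transitions *)

Section Soundness.

Variable T : pred nat.

(* [s] lists the matched elements of the down-set [D] together with some
   unmatched ones. *)
Definition partial D (s : seq nat) : Prop :=
  [/\ lin s, forall x, x < n -> matched x -> (x \in s) = inside D x &
      forall x y, x \in s -> R y x -> matched y -> y \in s].

(* Unmatched elements in [T] are only placed in front of a successor. *)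
Definition sound D z v : Prop :=
  exists s, [/\ partial D s,
    forall a, a \in s -> ~~ matched a -> T a -> exists2 c, c \in s & R a c,
    last n s = z & bonds s = v].

Lemma partial_unmatched D s a :
  partial D s -> a < n -> a \notin s -> avail D a -> partial D (rcons s a).
Proof.
move=> [ls ms cs] ha as_ /and3P[ma pa sa]; split.
- rewrite lin_rcons ls ha as_ /=; apply/allP => y ys; apply/negP => ay.
  have [|my] := boolP (matched y); last by rewrite unmatched_anti in ay.
  move=> my; have /andP[_ hy] := Rb ay.
  by have := succs_outP sa ay; rewrite -ms // ys.
- move=> x hx mx; rewrite mem_rcons inE ms // orb_idl // => /eqP e.
  by rewrite e (negbTE ma) in mx.
- move=> x y; rewrite !mem_rcons !inE => /orP[/eqP ->|xs] yx my.
    have /andP[hy _] := Rb yx.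
    by rewrite ms // (preds_inP pa yx) orbT.
  by rewrite (cs x y xs yx my) orbT.
Qed.

Lemma partial_matched D s b :
  partial D s -> b < n -> addable D b -> partial (D + weight b) (rcons s b).
Proof.
move=> [ls ms cs] hb ab; have mb := addable_matched hb ab; split.
- rewrite lin_rcons ls hb ms // (addable_notin ab) /=; apply/allP => y ys.
  apply/negP => yb; move: (addable_notin ab); rewrite -ms //.
  by rewrite (cs y b ys yb mb).
- by move=> x hx mx; rewrite mem_rcons inE ms // insideD.
- move=> x y; rewrite !mem_rcons !inE => /orP[/eqP ->|xs] yx my.
    have /andP[hy _] := Rb yx; case/andP: ab => pb _.
    by rewrite ms // (preds_inP pb yx) orbT.
  by rewrite (cs x y xs yx my) orbT.
Qed.

Lemma sound0 : sound 0 n 0.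
Proof.
exists [::]; split=> //; split=> // x hx mx.
by rewrite in_nil /inside /digit div0n mod0n leqNgt role_gt0 // mx.
Qed.

(** The down-set does not change, so reuse of a must be excluded by the order: z is the last
    element, and an earlier occurrence of a would precede its predecessor z. *)
Lemma sound_follower D z v a :
  sound D z v -> a < n -> avail D a -> ~~ T a -> R z a -> sound D a v.+1.
Proof.
move=> [s [ps ts lz bv]] ha aa Ta za.
have as_ : a \notin s.
  case: ps => ls _ _; case/lastP: s lz ls {ts bv} => [//|s y].
  rewrite last_rcons => ->; rewrite lin_rcons mem_rcons inE => /and4P[_ _ _ /allP h].
  apply/negP => /orP[/eqP e|]; first by rewrite e Rirr in za.
  by move/h; rewrite za.
exists (rcons s a); split; last 1 first.
- by rewrite bonds_rcons lz za bv addn1.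
- exact: partial_unmatched.
- move=> c; rewrite mem_rcons inE => /orP[/eqP -> _|cs mc Tc].
    by rewrite (negbTE Ta).
  by have [d ds cd] := ts c cs mc Tc; exists d; rewrite // mem_rcons inE ds orbT.
- by rewrite last_rcons.
Qed.

Lemma sound_matched D z v b :
  sound D z v -> b < n -> addable D b -> sound (D + weight b) b (v + R z b).
Proof.
move=> [s [ps ts lz bv]] hb ab.
exists (rcons s b); split; last 1 first.
- by rewrite bonds_rcons lz bv.
- exact: partial_matched.
- move=> c; rewrite mem_rcons inE => /orP[/eqP ->|cs mc Tc].
    by rewrite (addable_matched hb ab).
  by have [d ds cd] := ts c cs mc Tc; exists d; rewrite // mem_rcons inE ds orbT.
- by rewrite last_rcons.
Qed.

(** If a had been used before, then as an element of T it would have a successor in the list. That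
    successor is matched, hence inside D, and a would not be available. *)
Lemma sound_starter D z v a b :
  sound D z v -> a < n -> b < n -> avail D a -> addable D b -> T a -> R a b ->
  sound (D + weight b) b (v + (1 + R z a)).
Proof.
move=> [s [ps ts lz bv]] ha hb aa ab Ta rab.
have /and3P[ma _ sa] := aa.
have as_ : a \notin s.
  apply/negP => h; have [c cs ac] := ts a h ma Ta.
  have [mc|mc] := boolP (matched c); last by rewrite unmatched_anti in ac.
  have /andP[_ hc] := Rb ac; case: ps => _ ms _.
  by have := succs_outP sa ac; rewrite -ms // cs.
exists (rcons (rcons s a) b); split; last 1 first.
- by rewrite !bonds_rcons last_rcons lz bv rab -addnA [R z a + _]addnC.
- by apply: partial_matched => //; apply: partial_unmatched.
- move=> c; rewrite !(mem_rcons, inE) => /orP[/eqP ->|/orP[/eqP -> _ _|cs mc Tc]].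
  + by rewrite (addable_matched hb ab).
  + by exists b; rewrite // !(mem_rcons, inE) eqxx.
  + by have [d ds cd] := ts c cs mc Tc; exists d; rewrite // !(mem_rcons, inE) ds !orbT.
- by rewrite last_rcons.
Qed.

Lemma sound_bound D z v : sound D z v -> v <= n.
Proof.
move=> [s [[ls _ _] _ _ <-]]; apply: leq_trans (bonds_lt_size Rb _) _.
by apply: leq_trans (leq_pred _) _; apply: size_lin ls.
Qed.

Lemma sound_full D z v : sound D z v ->
  exists s, [/\ perm_eq s (iota 0 n), lin s & v <= bonds s].
Proof. by move=> [s [[ls _ _] _ _ <-]]; apply: lin_complete. Qed.

End Soundness.

Hypothesis sum_weight : (sumn (map weight (iota 0 n))).+1 = 3 ^ m.

(** * Completeness of the table along a given extension *)

Section Completeness.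

Variables (T : pred nat) (s : seq nat).
Hypothesis ps : perm_eq s (iota 0 n).
Hypothesis ls : lin s.

(** The additional head n shifts the positions by one, so that the entry is the element before a. At
    both ends of the list the neighbor is n, which is related to nothing. *)
Definition prev_bond a := R (nth n (n :: s) (index a s)) a.
Definition next_bond a := R a (nth n s (index a s).+1).
Definition starter a := next_bond a && ~~ prev_bond a.
Definition finisher a := prev_bond a && ~~ next_bond a.

Let us : uniq s. Proof. by case/and3P: ls. Qed.

Let ms x : (x \in s) = (x < n).
Proof. by rewrite (perm_mem ps) mem_iota. Qed.

Lemma index_cat_mid p h (t : seq nat) : s = p ++ h :: t ->
  prev_bond h = R (last n p) h /\ next_bond h = R h (head n t).
Proof.
move=> es; have hp : h \notin p.
  by move: us; rewrite es -cat_rcons cat_uniq rcons_uniq => /andP[/andP[]].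
rewrite /prev_bond /next_bond.
have -> : index h s = size p by rewrite es index_cat (negbTE hp) /= eqxx addn0.
split.
  by rewrite es -cat_cons nth_cat /= ltnS leqnn -last_nth.
by rewrite es nth_cat ltnNge leqnSn /= subSn // subnn /= nth0.
Qed.

Definition downset (p : seq nat) := sumn (map weight p).

Lemma downset_rcons p h : downset (rcons p h) = downset p + weight h.
Proof. by rewrite /downset map_rcons sumn_rcons. Qed.

Lemma downset_full : downset s = (3 ^ m).-1.
Proof.
rewrite -sum_weight /downset /= !sumnE; apply: perm_big; exact: perm_map.
Qed.

Lemma downset_lt p t : s = p ++ t -> downset p < 3 ^ m.
Proof.
move=> es; rewrite -sum_weight ltnS.
have -> : sumn (map weight (iota 0 n)) = downset s by rewrite downset_full -sum_weight.
by rewrite es /downset map_cat sumn_cat leq_addr.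
Qed.

Lemma digit_downset p t x : s = p ++ t -> x < n -> matched x ->
  digit (downset p) x = (x \in p) + (f x \in p).
Proof.
move=> es; elim/last_ind: p t es x => [|p h ih] t es x hx mx.
  by rewrite /downset /digit div0n.
have {}es : s = p ++ h :: t by rewrite es cat_rcons.
have hh : h < n by rewrite -ms es mem_cat inE eqxx orbT.
have hp : h \notin p.
  by move: us; rewrite es -cat_rcons cat_uniq rcons_uniq => /andP[/andP[]].
rewrite downset_rcons !mem_rcons !inE.
have [mh|mh] := boolP (matched h); last first.
  rewrite /weight (negbTE mh) addn0 (ih _ es) //.
  have -> : (x == h) = false by apply: contraNF mh => /eqP <-.
  by have -> : (f x == h) = false by apply: contraNF mh => /eqP <-; rewrite matched_f.
have dh : digit (downset p) h = (f h \in p) by rewrite (ih _ es) // (negbTE hp).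
rewrite digitD // ?dh; last by case: (_ \in _).
rewrite (ih _ es) //.
have [->|nxh] /= := eqVneq x h.
  by rewrite (negbTE hp) (negbTE mh : (f h == h) = false) /= addnC.
have -> : (x == f h) = (f x == h).
  by apply/eqP/eqP => [->|<-]; rewrite f_K.
have [e|] := eqVneq (f x) h; last by rewrite addn0.
by rewrite e (negbTE hp) /= addn0.
Qed.

(** A prefix of an extension is closed downwards, so the number of elements of a pair that it
    contains tells which ones they are. *)
Lemma inside_downset p t x : s = p ++ t -> x < n -> matched x ->
  inside (downset p) x = (x \in p).
Proof.
move=> es hx mx; rewrite /inside (digit_downset es) //.
have closed y z : z \in p -> R y z -> y \in p.
  move=> zp yz; have /andP[hy _] := Rb yz.
  move: hy; rewrite -ms es mem_cat => /orP[//|yt].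
  move: ls; rewrite es lin_cat => /and4P[_ _ _ /allrelP /(_ z y zp yt)].
  by rewrite yz.
have [_ _ /(_ mx)] := hf hx; rewrite /role /related.
have [xf _|] := boolP (R x (f x)).
  have [fp|] := boolP (f x \in p); first by rewrite (closed _ _ fp xf).
  by move=> _ /=; case: (x \in p).
move=> _ /= xf; rewrite xf.
have [xp|] := boolP (x \in p); first by rewrite (closed _ _ xp xf).
by move=> _ /=; case: (f x \in p).
Qed.

Lemma preds_in_downset p h t : s = p ++ h :: t -> preds_in (downset p) h.
Proof.
move=> es; apply/allP => x; rewrite mem_iota /= => hx; apply/implyP => xh.
have [mx|] := boolP (matched x); last first.
  by rewrite -role_gt0 // lt0n negbK /inside => /eqP ->.
rewrite (inside_downset es) //; move: (hx); rewrite -ms es mem_cat inE.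
case/orP=> // /orP[/eqP e|xt]; first by rewrite e Rirr in xh.
move: ls; rewrite es -cat_rcons lin_cat => /and4P[_ _ _ /allrelP /(_ h x)].
by rewrite mem_rcons inE eqxx xh => /(_ isT xt).
Qed.

Lemma avail_downset p h t : s = p ++ h :: t -> ~~ matched h -> avail (downset p) h.
Proof.
move=> es mh; rewrite /avail mh (preds_in_downset es) /=.
apply/allP => x _; apply/implyP => hx; have /andP[_ xn] := Rb hx.
have [mx|] := boolP (matched x); last by move=> mx; rewrite unmatched_anti in hx.
rewrite (inside_downset es) //; apply/negP => xp.
move: ls; rewrite es lin_cat => /and4P[_ _ _ /allrelP /(_ x h xp)].
by rewrite inE eqxx hx => /(_ isT).
Qed.

Lemma addable_downset p h t : s = p ++ h :: t -> matched h -> addable (downset p) h.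
Proof.
move=> es mh; rewrite /addable (preds_in_downset es) /=.
have hh : h < n by rewrite -ms es mem_cat inE eqxx orbT.
have hp : h \notin p.
  by move: us; rewrite es -cat_rcons cat_uniq rcons_uniq => /andP[/andP[]].
rewrite (digit_downset es) // (negbTE hp) add0n /role.
have [_ _ /(_ mh)] := hf hh; rewrite /related.
have [hf' _|] := boolP (R h (f h)).
  have [fp|//] := boolP (f h \in p).
  move: ls; rewrite es lin_cat => /and4P[_ _ _ /allrelP /(_ _ h fp)].
  by rewrite inE eqxx hf' => /(_ isT).
move=> _ /= fh; rewrite fh.
have := preds_in_downset es => /preds_inP /(_ fh).
by rewrite (inside_downset es) ?f_lt ?matched_f // => ->.
Qed.

Hypothesis hst : forall a, a < n -> ~~ matched a -> starter a -> T a.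
Hypothesis hfi : forall a, a < n -> ~~ matched a -> finisher a -> ~~ T a.

(** The finished table, seen only through its closure under the three transitions. Values are one
    more than a number of bonds, and 0 marks a missing entry. *)
Variable F : nat -> nat -> nat.
Hypothesis F0 : 0 < F 0 n.
Hypothesis F_follower : forall D z a, D < 3 ^ m -> z < n -> a < n -> 0 < F D z ->
  avail D a -> ~~ T a -> R z a -> F D z < F D a.
Hypothesis F_matched : forall D z b, D < 3 ^ m -> z <= n -> b < n -> 0 < F D z ->
  addable D b -> F D z + R z b <= F (D + weight b) b.
Hypothesis F_starter : forall D z a b, D < 3 ^ m -> z <= n -> a < n -> b < n ->
  0 < F D z -> avail D a -> addable D b -> T a -> R a b ->
  F D z + (1 + R z a) <= F (D + weight b) b.

(* The three cases: the last element of [p] is recorded in the table; it is a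
   pending element of [T], to be placed together with its successor; its bond
   with the next element does not exist, so that it may be forgotten. *)
Lemma table_walk p t : s = p ++ t ->
  exists z, [/\ z <= n, 0 < F (downset p) z &
    [\/ z = last n p /\ bonds p < F (downset p) z,
        [/\ last n p < n, ~~ matched (last n p), T (last n p),
            avail (downset p) (last n p) & R (last n p) (head n t)] /\
          bonds p < F (downset p) z + R z (last n p) |
        ~~ R (last n p) (head n t) /\ bonds p < F (downset p) z]].
Proof.
elim/last_ind: p t => [|p h ih] t es.
  by exists n; split=> //; apply: Or31; split=> //; rewrite /bonds.
have {}es : s = p ++ h :: t by rewrite es cat_rcons.
have [z [zn Fz hz]] := ih _ es; rewrite /= in hz.
have hh : h < n by rewrite -ms es mem_cat inE eqxx orbT.
have Dm := downset_lt es.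
have [pb nb] := index_cat_mid es.
rewrite downset_rcons last_rcons bonds_rcons.
have [mh|mh] := boolP (matched h).
  have ah := addable_downset es mh.
  have hb := F_matched Dm zn hh Fz ah.
  exists h; split; [exact: ltnW|exact: leq_trans (leq_trans Fz (leq_addr _ _)) hb|].
  apply: Or31; split=> //.
  case: hz => [[ez hz]|[[e1 e2 e3 e4 e5] hz]|[/negbTE -> hz]].
  - by apply: leq_trans hb; rewrite -ez ltn_add2r.
  - apply: leq_trans (F_starter Dm zn e1 hh Fz e4 ah e3 e5).
    by rewrite e5 add1n addnS addn1 !ltnS.
  (* The forgotten element has no bond with h, so any recorded z serves. *)
  - by apply: leq_trans hb; rewrite addn0; apply: leq_trans hz (leq_addr _ _).
have ah := avail_downset es mh.
have wh : weight h = 0 by rewrite /weight (negbTE mh).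
rewrite wh addn0.
have st := hst hh mh; have fi := hfi hh mh.
move: st fi; rewrite /starter /finisher pb nb.
set e := last n p in hz *; set h' := head n t.
have [eh|eh] := boolP (R e h).
  (* The bond between e and h leaves only the first case: e must be matched, because h is not and
     unmatched points form an antichain. *)
  have hz1 : z = e /\ bonds p < F (downset p) z.
    case: hz => [//|[[_ e2 _ _ _] _]|[]]; last by rewrite eh.
    by rewrite unmatched_anti in eh.
  case: hz1 => ez hz1 _; have [hh'|hh'] := boolP (R h h') => /= fi.
    have [Th|Th] := boolP (T h).
      exists z; split=> //; apply: Or32; split=> //.
      by rewrite ez eh ltn_add2r -ez.
    have := F_follower Dm _ hh Fz ah Th; rewrite ez eh => /(_ _ isT).
    have en : e < n by case/andP: (Rb eh).
    move=> /(_ en) hF; rewrite ez in hz1.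
    exists h; split; [exact: ltnW|exact: leq_ltn_trans (leq0n _) hF|].
    by apply: Or31; split=> //; rewrite addn1; apply: leq_trans hF.
  (* A bond before h and none after it: h is a finisher, hence outside T, and is placed as a
     follower. *)
  have Th := fi isT.
  have := F_follower Dm _ hh Fz ah Th; rewrite ez eh => /(_ _ isT).
  have en : e < n by case/andP: (Rb eh).
  move=> /(_ en) hF; rewrite ez in hz1.
  exists h; split; [exact: ltnW|exact: leq_ltn_trans (leq0n _) hF|].
  by apply: Or31; split=> //; rewrite addn1; apply: leq_trans hF.
have hz1 : bonds p < F (downset p) z.
  by case: hz => [[]|[[_ _ _ _]]|[]] //; rewrite (negbTE eh).
(* A bond after h and none before it makes h a starter, which stays pending in T; without either
   bond h is forgotten. *)
rewrite addn0; have [hh'|hh'] := boolP (R h h') => /= st _.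
  exists z; split=> //; apply: Or32; split; last exact: ltn_addr.
  by split=> //; apply: st.
by exists z; split=> //; apply: Or33.
Qed.

Lemma table_complete : exists2 z, z <= n & bonds s < F (3 ^ m).-1 z.
Proof.
have [z [zn _]] := table_walk (esym (cats0 s)); rewrite downset_full /= => hz.
exists z => //; case: hz => [[]|[[_ _ _ _]]|[]] //.
(* Behind the last element [head] gives n, so nothing is left pending. *)
by rewrite (Rn_r Rb).
Qed.

End Completeness.

(** * Starters and finishers against pairs *)

Section Partners.

Variable s : seq nat.
Hypothesis ps : perm_eq s (iota 0 n).
Hypothesis ls : lin s.

Local Notation ends P := [seq a <- iota 0 n | ~~ matched a & P s a].

(* A starter and a finisher each have a bond with a matched element; two of them
   cannot use the same pair, so there are at most as many as pairs. *)
Lemma starters_finishers : size (ends starter) + size (ends finisher) <= m.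
Proof.
pose nx a := nth n s (index a s).+1.
pose pv a := nth n (n :: s) (index a s).
pose p a := if starter s a then nx a else pv a.
pose low b := if R b (f b) then b else f b.
have us : uniq s by case/and3P: ls.
have ms x : (x \in s) = (x < n) by rewrite (perm_mem ps) mem_iota.
have mem_ends P a : a \in ends P -> [/\ a < n, ~~ matched a & P s a].
  by rewrite mem_filter mem_iota => /andP[/andP[-> ->] /= ->].
have sf a : finisher s a -> starter s a = false.
  by case/andP=> h1 h2; rewrite /starter h1 andbF.
set L := ends starter ++ ends finisher.
have memL a : a \in L ->
    [/\ a < n, ~~ matched a & (starter s a && R a (nx a)) ||
      [&& ~~ starter s a, finisher s a & R (pv a) a]].
  rewrite mem_cat => /orP[] /mem_ends[h1 h2 h3]; split=> //.
    by case/andP: (h3) => h _; rewrite h3 (h : R a (nx a)).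
  by case/andP: (h3) => h _; rewrite (sf _ h3) h3 (h : R (pv a) a).
have cmpL a : a \in L -> cmp a (p a).
  by move=> /memL[_ _];
    rewrite /p /related => /orP[/andP[-> ->]|/and3P[/negbTE -> _ ->]] //; rewrite orbT.
have cmp_lt a b : cmp a b -> b < n by case/orP=> /Rb/andP[].
have cmp_m a b : ~~ matched a -> cmp a b -> matched b.
  by move=> ma; apply: contraTT => mb; rewrite /related !unmatched_anti.
have index_inj a b : a < n -> b < n -> index a s = index b s -> a = b.
  by rewrite -!ms => ha hb e; rewrite -(nth_index n ha) e nth_index.
have lowE b : b < n -> matched b -> low b \in lowers /\ (low b = b \/ low b = f b).
  move=> hb mb; have [h1 h2 /(_ mb)] := hf hb; rewrite /low mem_filter mem_iota /related.
  case: ifP => [h _|_ /= h]; first by rewrite h; split=> //; left.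
  by rewrite h2 h; split=> //; right.
have nx_inj a b : a < n -> b < n -> R a (nx a) -> nx a = nx b -> a = b.
  move=> ha hb ra e; apply: index_inj => //.
  have sz c : nx c != n -> (index c s).+1 < size s.
    by apply: contraNltn => h; rewrite /nx nth_default.
  have na : nx a != n by apply: contraTneq ra => ->; rewrite (Rn_r Rb).
  have nb : nx b != n by rewrite -e.
  by have /eqP := e; rewrite (nth_uniq n (sz _ na) (sz _ nb) us) eqSS => /eqP.
have pv_inj a b : a < n -> b < n -> R (pv a) a -> pv a = pv b -> a = b.
  move=> ha hb ra e; apply: index_inj => //; move: e.
  have na : pv a != n by apply: contraTneq ra => ->; rewrite (Rn_l Rb).
  move=> e; have nb : pv b != n by rewrite -e.
  move: na nb e; rewrite /pv.
  have: index a s < size s by rewrite index_mem ms.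
  have: index b s < size s by rewrite index_mem ms.
  case: (index a s) (index b s) => [|i] [|j] //=; rewrite ?eqxx // => hj hi _ _ /eqP.
  by rewrite (nth_uniq n (ltnW hi) (ltnW hj) us) => /eqP ->.
have p_inj : {in L &, injective (low \o p)}.
  move=> a b aL bL /= e.
  have [ha ma ca] := memL a aL; have [hb mb cb] := memL b bL.
  have [cpa cpb] := (cmpL a aL, cmpL b bL).
  have [pa pb] := (cmp_lt _ _ cpa, cmp_lt _ _ cpb).
  have [mpa mpb] := (cmp_m _ _ ma cpa, cmp_m _ _ mb cpb).
  (* Bonds into the same pair use either the same end or opposite ends. *)
  have [epp|epp] : p a = p b \/ p b = f (p a).
    have [_ [e1|e1]] := lowE _ pa mpa; have [_ [e2|e2]] := lowE _ pb mpb;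
      move: e; rewrite e1 e2 => e.
    + by left. + by right; rewrite e f_K.
    + by right. + by left; rewrite -(f_K pa) e f_K.
  move: epp ca cb cpa cpb; rewrite /p.
  case: (starter s a); case: (starter s b); rewrite /= ?andbF ?andbT ?orbF.
  + by move=> e' ra rb _ _; apply: nx_inj.
  (* A starter below and a finisher above the same element would be comparable by transitivity,
     against the antichain. *)
  + by move=> e' ra /andP[_ rb]; have := Rtr ra; rewrite e' => /(_ _ rb);
    rewrite unmatched_anti.
  + by move=> e' /andP[_ ra] rb; have := Rtr rb; rewrite -e' => /(_ _ ra);
    rewrite unmatched_anti.
  + by move=> e' /andP[_ ra] /andP[_ rb] _ _; apply: pv_inj.
  (* Opposite ends: for different points this would be an augmenting path of length 3. *)
  by apply: (unmatched_pair ma mb mpa ha hb pa cpa); rewrite -epp.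
rewrite -size_cat -/L -(size_map (low \o p)).
apply: uniq_leq_size.
  rewrite map_inj_in_uniq // cat_uniq !filter_uniq ?iota_uniq //= andbT.
  apply/hasPn => a /mem_ends[_ _ fa]; apply/negP => /mem_ends[_ _].
  by rewrite (sf _ fa).
move=> b /mapP[a aL ->] /=; have [_ ma _] := memL a aL.
by have [] := lowE _ (cmp_lt _ _ (cmpL a aL)) (cmp_m _ _ ma (cmpL a aL)).
Qed.

End Partners.
End DynamicProgram.

(** * Numbering the pairs of a matching *)

Lemma sum_pow3 k : (2 * \sum_(i < k) 3 ^ i).+1 = 3 ^ k.
Proof.
elim: k => [|k ih]; first by rewrite big_ord0.
by rewrite big_ord_recr /= mulnDr -addSn ih -{1}[3 ^ k]mul1n -mulnDl expnS.
Qed.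

Section PairIndex.

Variables (n : nat) (R : rel nat).
Hypothesis Rb : forall x y, R x y -> (x < n) && (y < n).
Hypothesis Rirr : irreflexive R.
Hypothesis Rtr : transitive R.
Variable f : nat -> nat.
Hypothesis hf : matching n R f.

Definition lower x := if R x (f x) then x else f x.
Definition pair_index x := index (lower x) (lowers n R f).

Lemma pair_indexE x : pair_index x = index (lower x) (lowers n R f).
Proof. by []. Qed.

Lemma lower_f x : x < n -> matched f x -> lower (f x) = lower x.
Proof.
move=> hx mx; have [_ ffx /(_ mx)] := hf hx; rewrite /lower ffx /related.
have [xf|] := boolP (R x (f x)); first by rewrite (R_asym Rirr Rtr xf).
by move=> _ /= h; rewrite h.
Qed.

Lemma mem_lowers x : x < n -> (x \in lowers n R f) = R x (f x).
Proof. by move=> hx; rewrite mem_filter mem_iota /= add0n hx andbT. Qed.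

Lemma lower_mem x : x < n -> matched f x -> lower x \in lowers n R f.
Proof.
move=> hx mx; have [fx ffx /(_ mx)] := hf hx; rewrite /lower /related.
by case: ifP => [h _|_ /= h]; rewrite mem_lowers ?ffx.
Qed.

Lemma pair_index_f x : x < n -> pair_index (f x) = pair_index x.
Proof.
move=> hx; have [mx|] := boolP (matched f x); first by rewrite /pair_index lower_f.
by rewrite /matched negbK => /eqP ->.
Qed.

Lemma pair_index_inj x y : x < n -> y < n -> matched f x -> matched f y ->
  pair_index x = pair_index y -> y = x \/ y = f x.
Proof.
move=> hx hy mx my e.
have {e} e : lower x = lower y.
  by rewrite -(nth_index n (lower_mem hx mx)) -/(pair_index x) e nth_index // lower_mem.
have [_ ffx _] := hf hx; have [_ ffy _] := hf hy.
move: e; rewrite /lower; case: ifP => _; case: ifP => _ e.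
- by left.
- by right; rewrite e ffy.
- by right.
- by left; rewrite -ffx e ffy.
Qed.

Lemma matched_R x : x < n -> matched f x = R x (f x) || R (f x) x.
Proof.
move=> hx; have [_ _ h] := hf hx; apply/idP/idP; first exact: h.
by apply: contraTT; rewrite negbK => /eqP ->; rewrite Rirr.
Qed.

Lemma uniq_lowers : uniq (lowers n R f).
Proof. by rewrite filter_uniq ?iota_uniq. Qed.

Lemma lowers_lt x : x \in lowers n R f -> x < n /\ R x (f x).
Proof. by rewrite mem_filter mem_iota => /andP[-> /= ->]. Qed.

Lemma perm_matched :
  perm_eq [seq x <- iota 0 n | matched f x]
          (lowers n R f ++ map f (lowers n R f)).
Proof.
have ff x : x < n -> f (f x) = x by case/hf.
apply: uniq_perm; rewrite ?filter_uniq ?iota_uniq //.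
  rewrite cat_uniq uniq_lowers map_inj_in_uniq ?uniq_lowers ?andbT /=; last first.
    by move=> x y /lowers_lt[hx _] /lowers_lt[hy _] e; rewrite -(ff x hx) e ff.
  apply/hasPn => _ /mapP[x /lowers_lt[hx xf] ->] /=; apply/negP => /lowers_lt[_].
  by rewrite ff // (R_asym Rirr Rtr xf).
move=> x; rewrite mem_filter mem_iota mem_cat /= add0n.
apply/andP/orP => [[mx hx]|[/lowers_lt[hx xf]|/mapP[y /lowers_lt[hy yf] ->]]].
- rewrite mem_lowers //; move: mx; rewrite matched_R // => /orP[->|h]; [by left|right].
  have [fx _ _] := hf hx; apply/mapP; exists (f x); rewrite ?ff //.
  by rewrite mem_lowers ?ff.
- by rewrite matched_R // xf.
- by have [fy _ _] := hf hy; rewrite matched_R ?ff // yf orbT.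
Qed.

Lemma double_lowers : (size (lowers n R f)).*2 + count (predC (matched f)) (iota 0 n) = n.
Proof.
have := perm_size perm_matched; rewrite size_cat size_map size_filter addnn => <-.
by rewrite count_predC size_iota.
Qed.

(** Every pair contributes its power of 3 twice, so the full down-set has all digits equal to 2 and
    code 3^m - 1. *)
Lemma sum_weight_pairs :
  (sumn (map (weight f pair_index) (iota 0 n))).+1 = 3 ^ size (lowers n R f).
Proof.
rewrite sumnE big_map /weight -big_mkcond -big_filter (perm_big _ perm_matched) /=.
rewrite big_cat big_map /= -sum_pow3 mul2n -addnn; congr (_ + _).+1.
  rewrite (big_nth n) big_mkord; apply: eq_bigr => i _; congr (3 ^ _).
  have /lowers_lt[_ h] := mem_nth n (ltn_ord i).
  by rewrite /pair_index /lower h index_uniq ?uniq_lowers.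
rewrite (big_nth n) big_mkord; apply: eq_bigr => i _; congr (3 ^ _).
have /lowers_lt[hx h] := mem_nth n (ltn_ord i).
by rewrite pair_index_f // /pair_index /lower h index_uniq ?uniq_lowers.
Qed.

End PairIndex.

(** * Counting the states *)

Section SmallSubsets.

Variables (U : pred nat) (K : nat).

Definition add_point (a : nat) (l : seq (nat * nat)) : seq (nat * nat) :=
  [seq (p.1 + 2 ^ a, p.2.+1) | p <- l & p.2 < K].

(* The subsets of [U] below [a] of size at most [K], as bit masks paired with
   their sizes. *)
Fixpoint subsets (a : nat) : seq (nat * nat) :=
  if a is a'.+1 then
    if U a' then subsets a' ++ add_point a' (subsets a') else subsets a'
  else [:: (0, 0)].

Lemma subsets_lt a p : p \in subsets a -> p.1 < 2 ^ a /\ p.2 <= K.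
Proof.
elim: a p => [|a ih] p /=; first by rewrite inE => /eqP ->.
have e : 2 ^ a.+1 = 2 ^ a + 2 ^ a by rewrite expnS mul2n addnn.
rewrite e; case: (U a) => [|/ih[h1 h2]]; last by rewrite ltn_addr.
rewrite mem_cat => /orP[/ih[h1 h2]|/mapP[p']]; first by rewrite ltn_addr.
by rewrite mem_filter => /andP[/= h /ih[h1 h2]] -> /=; rewrite ltn_add2r.
Qed.

Lemma size_add_point a l : size (add_point a l) <= size l.
Proof. by rewrite size_map size_filter count_size. Qed.

Lemma size_subsets a : size (subsets a) <= 2 ^ a.
Proof.
elim: a => //= a ih; rewrite expnS; case: (U a); last by lia.
by rewrite size_cat; have := size_add_point a (subsets a); lia.
Qed.

Lemma size_subsets_gt0 a : 0 < size (subsets a).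
Proof. by elim: a => //= a ih; case: (U a); rewrite // size_cat addn_gt0 ih. Qed.

Lemma size_subsets_mono a a' : a <= a' -> size (subsets a) <= size (subsets a').
Proof.
move=> /subnK <-; elim: (a' - a) => //= d ih.
by case: (U _) => //; rewrite size_cat; lia.
Qed.

Lemma mask_add p a x : p < 2 ^ a ->
  ((p + 2 ^ a) %/ 2 ^ x) %% 2 = if x == a then 1 else (p %/ 2 ^ x) %% 2.
Proof.
move=> hp; have e2 k : 0 < 2 ^ k by rewrite expn_gt0.
have [->|nxa] := eqVneq x a.
  by rewrite -{1}[2 ^ a]mul1n divnDMl // divn_small.
have [xa|ax|/eqP] := ltngtP x a; last by rewrite (negbTE nxa).
  have -> : a = (a - x).-1.+1 + x by lia.
  rewrite expnD divnDMl // expnS mulnC addnC modnMDl //.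
have h : 2 ^ a.+1 <= 2 ^ x by rewrite leq_exp2l.
by rewrite !divn_small //; move: h; rewrite expnS; lia.
Qed.

Lemma subsets_complete a (S : pred nat) :
  (forall x, S x -> U x) -> count S (iota 0 a) <= K ->
  exists p, [/\ p \in subsets a, p.2 = count S (iota 0 a) &
                forall x, (p.1 %/ 2 ^ x) %% 2 = (x < a) && S x :> nat].
Proof.
move=> SU; elim: a => [|a ih].
  by exists (0, 0); split=> // x; rewrite div0n.
rewrite -addn1 iotaD count_cat /= addn0 add0n => h.
have [|p [pa p2 px]] := ih; first by lia.
have [Sa|Sa] := boolP (S a); rewrite ?addn1 /=; last first.
  exists p; split=> [||x].
  - by case: (U a); rewrite // mem_cat pa.
  - by rewrite addn0.
  - rewrite px ltnS [in RHS]leq_eqVlt; case: eqP => [->|//].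
    by rewrite (negbTE Sa) !andbF.
exists (p.1 + 2 ^ a, p.2.+1); split=> [||x] /=.
- rewrite (SU _ Sa) mem_cat; apply/orP; right; apply/mapP; exists p => //.
  by rewrite mem_filter pa andbT p2; rewrite Sa addn1 in h.
- by rewrite p2 -addn1.
- have [hp _] := subsets_lt pa; rewrite mask_add // px ltnS [in RHS]leq_eqVlt.
  by case: eqP => [->|//]; rewrite Sa.
Qed.

End SmallSubsets.

(** * Exponential estimates over the rationals *)

Section Growth.

Import Order.TTheory GRing.Theory Num.Theory.
Local Open Scope ring_scope.

(** Without the restriction to size K this is the binomial theorem, with equality; dropping sets
    only lowers the sum. *)
Lemma subsets_weight (U : pred nat) (K a : nat) (z : rat) : 0 <= z ->
  \sum_(p <- subsets U K a) z ^+ p.2 <= (1 + z) ^+ count U (iota 0 a).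
Proof.
move=> z0; elim: a => [|a ih]; first by rewrite big_seq1 !expr0.
rewrite -addn1 iotaD count_cat /= addn0 add0n addn1 /=; case: (U a) => /=;
  last by rewrite addn0.
rewrite big_cat /= addn1 exprS mulrDl mul1r lerD //.
apply: le_trans (ler_wpM2l z0 ih).
rewrite big_map big_filter mulr_sumr big_mkcond /=.
apply: ler_sum => p _; case: ifP => _; first by rewrite exprS.
by rewrite mulr_ge0 ?exprn_ge0.
Qed.

(** As z <= 1, each of the sets has weight at least z^K. *)
Lemma size_subsets_weight (U : pred nat) (K a : nat) (z : rat) : 0 <= z <= 1 ->
  (size (subsets U K a))%:R * z ^+ K <= (1 + z) ^+ count U (iota 0 a).
Proof.
case/andP=> z0 z1; apply: le_trans (subsets_weight U K a z0).
have -> : (size (subsets U K a))%:R * z ^+ K = \sum_(p <- subsets U K a) z ^+ K.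
  by rewrite big_const_seq count_predT iter_addr_0 mulr_natl.
rewrite !big_seq; apply: ler_sum => p /subsets_lt[_ h].
by rewrite ler_wiXn2l.
Qed.

(** Multiplied by z^(m/2), the number of sets is at most (1 + z)^(n - 2m). It remains to pay for 3^m
    with z^(m/2) (1 + z)^(2m), which for each pair is the square root of 9 <= z (1 + z)^4. *)
Lemma states_bound (U : pred nat) (m n : nat) (z : rat) :
  0 < z <= 1 -> 9 <= z * (1 + z) ^+ 4 ->
  (m.*2 + count U (iota 0 n))%N = n ->
  (size (subsets U m./2 n) * 3 ^ m)%:R <= (1 + z) ^+ n.
Proof.
case/andP=> z0 z1 z9 e; set N := count _ _ in e.
have w0 : 0 < 1 + z by rewrite addr_gt0.
have hs := size_subsets_weight U m./2 n (introT andP (conj (ltW z0) z1)).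
have key : 3 ^+ m <= z ^+ m./2 * (1 + z) ^+ m.*2.
  have zw : 0 <= z ^+ m./2 * (1 + z) ^+ m.*2 by rewrite mulr_ge0 ?exprn_ge0 // ltW.
  have nn3 : 0 <= 3 ^+ m :> rat by rewrite exprn_ge0.
  (* After squaring, the rounding in [m./2] is harmless: twice it is at most m, and z <= 1. *)
  suff: (3 ^+ m) ^+ 2 <= (z ^+ m./2 * (1 + z) ^+ m.*2) ^+ 2 :> rat.
    by rewrite ler_pXn2r ?nnegrE.
  rewrite exprMn -!exprM [(m * 2)%N]mulnC exprM (_ : 3 ^+ 2 = 9 :> rat); last by ring.
   apply: le_trans (_ : (z * (1 + z) ^+ 4) ^+ m <= _).
    by rewrite lerXn2r // nnegrE mulr_ge0 ?exprn_ge0 // ltW.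
  rewrite exprMn -exprM; have -> : (m.*2 * 2 = 4 * m)%N by lia.
  rewrite ler_pM2r ?exprn_gt0 //; apply: ler_wiXn2l => //; [exact: ltW|lia].
have -> : (1 + z) ^+ n = (1 + z) ^+ N * (1 + z) ^+ m.*2 by rewrite -exprD addnC e.
rewrite natrM natrX.
rewrite -(ler_pM2l (exprn_gt0 m./2 z0)) mulrA [X in _ <= X]mulrCA.
rewrite [z ^+ _ * _%:R]mulrC.
by apply: ler_pM; rewrite ?mulr_ge0 ?exprn_ge0 ?ler0n // ltW.
Qed.

(** From n to n + 1 the right side grows by (1 + 1/k)^n, which is at least 1. *)
Lemma linear_le_exp (k n : nat) : (0 < k)%N ->
  n.+1%:R <= k%:R * (1 + k%:R^-1) ^+ n :> rat.
Proof.
move=> k0; have k1 : 1 <= k%:R :> rat by rewrite ler1n.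
have kp : 0 < k%:R :> rat by rewrite ltr0n.
elim: n => [|n ih]; first by rewrite expr0 mulr1.
have h : 1 <= (1 + k%:R^-1) ^+ n :> rat.
  by rewrite exprn_ege1 // lerDl invr_ge0 ltW.
rewrite exprS mulrCA mulrDl mul1r -[n.+2]addn1 natrD lerD //.
by rewrite mulrA mulVf ?gt_eqF // mul1r.
Qed.

Lemma poly_le_exp (d k n : nat) (r : rat) : (0 < k)%N ->
  (1 + k%:R^-1) ^+ d <= r -> n.+1%:R ^+ d <= k%:R ^+ d * r ^+ n.
Proof.
move=> k0 hr; have kp : 0 < k%:R :> rat by rewrite ltr0n.
have e0 : 0 <= 1 + k%:R^-1 :> rat by rewrite addr_ge0 // invr_ge0 ltW.
apply: le_trans (_ : (k%:R * (1 + k%:R^-1) ^+ n) ^+ d <= _).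
  by rewrite lerXn2r ?linear_le_exp // ?nnegrE // mulr_ge0 ?exprn_ge0 // ltW.
rewrite exprMn -exprM mulnC exprM ler_pM2l ?exprn_gt0 //.
by rewrite lerXn2r // nnegrE ?exprn_ge0 // (le_trans _ hr) ?exprn_ge0.
Qed.

End Growth.

(** * The program *)

(* Cell d (n + 1) + z of [aTable] holds 1 plus the largest number of bonds found
   for a partial extension with down-set d and last element z, or 0 if there is
   none yet; z = n stands for the empty extension. [aMask] and [aCard] list the
   candidate sets of unmatched points as bit masks with their sizes. *)

Notation aMate := 0 (only parsing).
Notation aRole := 1 (only parsing).
Notation aWeight := 2 (only parsing).
Notation aPow := 3 (only parsing).
Notation aPairs := 4 (only parsing).
Notation aMask := 5 (only parsing).
Notation aCard := 6 (only parsing).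
Notation aLen := 7 (only parsing).
Notation aBit := 8 (only parsing).
Notation aStart := 9 (only parsing).
Notation aRest := 10 (only parsing).
Notation aTable := 11 (only parsing).
Notation aDigit := 12 (only parsing).
Notation aInside := 13 (only parsing).
Notation aAddable := 14 (only parsing).
Notation aAvail := 15 (only parsing).
Notation aGain := 16 (only parsing).
Notation aBest := 17 (only parsing).
Notation aU := 18 (only parsing).
Notation aV := 19 (only parsing).
Notation aX := 20 (only parsing).
Notation cX := 21 (only parsing).
Notation cY := 22 (only parsing).
Notation cI := 23 (only parsing).
Notation cT := 24 (only parsing).
Notation cK := 25 (only parsing).
Notation cC := 26 (only parsing).
Notation cD := 27 (only parsing).

Declare Scope jterm_scope.
Delimit Scope jterm_scope with trm.
Bind Scope jterm_scope with term.
Arguments TRel (_ _)%_trm.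
Arguments TCell _%_N _%_trm.
Arguments TAdd (_ _)%_trm.
Arguments TSub (_ _)%_trm.
Arguments TMul (_ _)%_trm.
Arguments TDiv (_ _)%_trm.
Arguments TMod (_ _)%_trm.
Arguments TEq (_ _)%_trm.
Arguments TMax (_ _)%_trm.
Arguments PSet _%_N (_ _)%_trm.
Coercion TConst : nat >-> term.
Notation "a + b" := (TAdd a b) : jterm_scope.
Notation "a - b" := (TSub a b) : jterm_scope.
Notation "a * b" := (TMul a b) : jterm_scope.
Notation "a %/ b" := (TDiv a b) : jterm_scope.
Notation "a %% b" := (TMod a b) : jterm_scope.
Notation "a == b" := (TEq a b) : jterm_scope.
Notation "j @[ t ]" := (TCell j t) (at level 2, format "j @[ t ]") : jterm_scope.
Notation "! j" := (TCell j 0) (at level 2, format "! j") : jterm_scope.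
Declare Scope jprog_scope.
Delimit Scope jprog_scope with prg.
Bind Scope jprog_scope with prog.
Arguments PSeq (_ _)%_prg.
Arguments PIf _%_trm _%_prg.
Arguments PFor _%_N _%_trm _%_prg.
Notation "p ;; q" := (PSeq p q) (at level 85, right associativity) : jprog_scope.
Notation "'If' t 'Then' p 'End'" := (PIf t p)
  (at level 0, t at level 75, p at level 90) : jprog_scope.
Notation "'For' j 'Below' t 'Do' p 'End'" := (PFor j t p)
  (at level 0, j at level 0, t at level 75, p at level 90) : jprog_scope.

(** The predicate [augmenting] in arithmetic: products are conjunctions, sums are disjunctions. *)
Definition mate_cond : term :=
  ((aMate @[!aU] == !aU) * (aMate @[!aV] == !aV) * (1 - (!aU == !aV))
   * (TRel (!aU) (!aX) + TRel (!aX) (!aU))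
   * ((!aX == !aV) + (1 - (aMate @[!aX] == !aX))
        * (TRel (!aV) (aMate @[!aX]) + TRel (aMate @[!aX]) (!aV))))%trm.

(** The counter codes the triple (u, v, x) in base n. The writes come in the reverse order of the
    tests in [augment], because the last write to a cell prevails. *)
Definition match_try : prog :=
  (PSet aU 0 (!cT %/ (TSize * TSize));;
   PSet aV 0 ((!cT %/ TSize) %% TSize);;
   PSet aX 0 (!cT %% TSize);;
   If mate_cond Then
     PSet aMate (!aV) (aMate @[!aX]);;
     PSet aMate (aMate @[!aX]) (!aV);;
     PSet aMate (!aU) (!aX);;
     PSet aMate (!aX) (!aU)
   End)%prg.

Definition match_sweep : prog :=
  (For cT Below TSize * TSize * TSize Do match_try End)%prg.

(** A sweep that starts from an augmentable matching ends with more covered points, and at most n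
    points can be covered; so n + 1 sweeps suffice. *)
Definition match_prog : prog :=
  (For cX Below TSize Do PSet aMate (!cX) (!cX) End;;
   For cI Below TSize + 1 Do match_sweep End)%prg.

Definition pairs_prog : prog :=
  (PSet aPow 0 1;;
   PSet aPairs 0 0;;
   For cX Below TSize Do
     If TRel (!cX) (aMate @[!cX]) Then
       PSet aRole (!cX) 1;;
       PSet aRole (aMate @[!cX]) 2;;
       PSet aWeight (!cX) (!aPow);;
       PSet aWeight (aMate @[!cX]) (!aPow);;
       PSet aPow 0 (!aPow * 3);;
       PSet aPairs 0 (!aPairs + 1)
     End
   End)%prg.

(** The bound of the inner loop is the length of the list at its start, so sets appended for a point
    are not extended by the same point again. *)
Definition subsets_prog : prog :=
  (PSet aMask 0 0;;
   PSet aCard 0 0;;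
   PSet aLen 0 1;;
   PSet aBit 0 1;;
   For cX Below TSize Do
     If 1 - aRole @[!cX] Then
       For cK Below !aLen Do
         If (!aPairs %/ 2) - aCard @[!cK] Then
           PSet aMask (!aLen) (aMask @[!cK] + !aBit);;
           PSet aCard (!aLen) (aCard @[!cK] + 1);;
           PSet aLen 0 (!aLen + 1)
         End
       End
     End;;
     PSet aBit 0 (!aBit * 2)
   End)%prg.

(** An unmatched point has weight 0, and the quotient by 0 is 0, on the machine as in [digit]. *)
Definition row_digits : prog :=
  (For cX Below TSize Do
     PSet aDigit (!cX) ((!cD %/ aWeight @[!cX]) %% 3);;
     PSet aInside (!cX) (1 - (aRole @[!cX] - aDigit @[!cX]))
   End)%prg.

(** During the inner loop the two arrays accumulate [preds_in] and [succs_out]; they are combined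
    afterwards. *)
Definition row_flags : prog :=
  (For cY Below TSize Do
     PSet aAddable (!cY) 1;;
     PSet aAvail (!cY) 1;;
     For cX Below TSize Do
       PSet aAddable (!cY) (aAddable @[!cY] * (1 - TRel (!cX) (!cY) * (1 - aInside @[!cX])));;
       PSet aAvail (!cY) (aAvail @[!cY] * (1 - TRel (!cY) (!cX) * aInside @[!cX]))
     End;;
     PSet aAvail (!cY) ((1 - aRole @[!cY]) * (aAddable @[!cY] * aAvail @[!cY]));;
     PSet aAddable (!cY) (aAddable @[!cY] * (aDigit @[!cY] + 1 == aRole @[!cY]))
   End)%prg.

Definition entry (tD tz : term) : term := (tD * (TSize + 1) + tz)%trm.

(** A single pass in any order suffices although it reads and writes the same row: entries are
    written for unmatched points, while the predecessor read for an unmatched point is matched. *)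
Definition row_followers : prog :=
  (For cT Below TSize * TSize Do
     PSet aU 0 (!cT %/ TSize);;
     PSet aV 0 (!cT %% TSize);;
     If aTable @[entry (!cD) (!aU)] * aAvail @[!aV] * (1 - aStart @[!aV])
        * TRel (!aU) (!aV) Then
       PSet aTable (entry (!cD) (!aV)) (TMax (aTable @[entry (!cD) (!aV)]) (aTable @[entry (!cD) (!aU)] + 1))
     End
   End)%prg.

(** Matched elements have positive weight, so all writes go to later rows, and a row is final once
    its own followers are done. *)
Definition row_matched : prog :=
  (For cT Below (TSize + 1) * TSize Do
     PSet aU 0 (!cT %/ TSize);;
     PSet aV 0 (!cT %% TSize);;
     PSet aGain 0 (TRel (!aU) (!aV));;
     For cX Below TSize Do
       If aAvail @[!cX] * aStart @[!cX] * TRel (!cX) (!aV) Then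
         PSet aGain 0 (TMax (!aGain) (1 + TRel (!aU) (!cX)))
       End
     End;;
     If aTable @[entry (!cD) (!aU)] * aAddable @[!aV] Then
       PSet aTable (entry (!cD + aWeight @[!aV]) (!aV)) (TMax (aTable @[entry (!cD + aWeight @[!aV]) (!aV)]) (aTable @[entry (!cD) (!aU)] + !aGain))
     End
   End)%prg.

Definition row_prog : prog :=
  (row_digits;; row_flags;; row_followers;; row_matched)%prg.

Definition table_prog : prog :=
  (For cX Below !aPow * (TSize + 1) Do PSet aTable (!cX) 0 End;;
   PSet aTable (TSize) 1;;
   For cD Below !aPow Do row_prog End)%prg.

Definition round_prog : prog :=
  (PSet aRest 0 (aMask @[!cK]);;
   For cX Below TSize Do
     PSet aStart (!cX) ((!aRest + !cC) %% 2);;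
     PSet aRest 0 (!aRest %/ 2)
   End;;
   table_prog;;
   For cX Below TSize + 1 Do
     PSet aBest 0 (TMax (!aBest) (aTable @[entry (!aPow - 1) (!cX)]))
   End)%prg.

Definition main_prog : prog :=
  (PSet aBest 0 0;;
   For cK Below !aLen Do For cC Below 2 Do round_prog End End)%prg.

Definition jump_prog : prog :=
  (match_prog;; pairs_prog;; subsets_prog;; main_prog)%prg.

Lemma jump_prog_wf : pwf jump_prog.
Proof. by []. Qed.

Section Programs.

Variables (n : nat) (R : rel nat) (b : nat).
Hypothesis Rb : forall x y, R x y -> (x < n) && (y < n).
Hypothesis Rirr : irreflexive R.
Hypothesis Rtr : transitive R.

Local Notation wp := (wp n R b).
Local Notation prun := (prun n R).
Local Notation safe := (safe n R b).

Lemma wp_set_seq j t1 t2 p T (Q : state -> Prop) s :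
  teval n R s t2 < 2 ^ b ->
  wp p T Q (upd s j (teval n R s t1) (teval n R s t2)) ->
  wp (PSeq (PSet j t1 t2) p) T.+1 Q s.
Proof. by move=> h [h1 h2 h3]; split. Qed.

Hypothesis bn : 3 * n + 8 <= b.

(** The numbers of the program are of two kinds, either cubic like the bound n^3 of a sweep, or of
    the order of the table length 3^m (n + 1) <= 2^n (n + 1). Words of 3n + 8 bits hold both. *)
Lemma b_cube k : k <= (n + 2) ^ 3 -> k < 2 ^ b.
Proof.
move=> h; apply: leq_ltn_trans h _.
have e : 2 ^ (3 * n + 8) = 256 * (2 ^ n * 2 ^ n * 2 ^ n).
  by rewrite -[256]/(2 ^ 8) -!expnD; congr (2 ^ _); lia.
apply: leq_trans (leq_pexp2l (isT : 0 < 2) bn); rewrite e.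
have h1 : n < 2 ^ n by apply: ltn_expl.
move: (2 ^ n) h1 => E h1.
have h2 : (n + 2) ^ 3 <= (2 * E) ^ 3 by rewrite leq_exp2r //; lia.
apply: leq_ltn_trans h2 _; have -> : (2 * E) ^ 3 = 2 ^ 3 * (E * E * E) 
  by rewrite expnMn; congr (_ * _); rewrite !expnS expn0 muln1 mulnA.
by rewrite ltn_pmul2r // !muln_gt0; lia.
Qed.

Lemma b_exp k : k <= 2 ^ n * (n + 2) -> k < 2 ^ b.
Proof.
move=> h; apply: leq_ltn_trans h _.
have h1 : n < 2 ^ n by apply: ltn_expl.
apply: leq_trans (leq_pexp2l (isT : 0 < 2) bn).
have e : 2 ^ (3 * n + 8) = 256 * (2 ^ n * 2 ^ n * 2 ^ n).
  by rewrite -[256]/(2 ^ 8) -!expnD; congr (2 ^ _); lia.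
rewrite e; move: (2 ^ n) h1 => E h1.
apply: leq_ltn_trans (_ : E * (2 * E) < _); first by rewrite leq_mul2l; lia.
by nia.
Qed.

Lemma b_small k : k <= n + 4 -> k < 2 ^ b.
Proof. by move=> h; apply: b_cube; rewrite !expnS expn0; nia. Qed.

Lemma mate_condE s : let f := s aMate in
  (teval n R s mate_cond != 0) =
  augmenting R f (s aU 0) (s aV 0) (s aX 0).
Proof.
have e1 (c : bool) : (1 - c == 0) = c by case: c.
rewrite /= /augmenting /related !(muln_eq0, addn_eq0, e1, eqb0).
by rewrite !(negb_or, negb_and, negbK) -!andbA.
Qed.

End Programs.

(** * Correctness and cost *)

Section Match.

Variables (n : nat) (R : rel nat) (b : nat).
Hypothesis Rirr : irreflexive R.
Hypothesis bn : 3 * n + 8 <= b.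

Local Notation wp := (wp n R b).
Local Notation dec_u t := (t %/ (n * n)).
Local Notation dec_v t := (t %/ n %% n).
Local Notation dec_x t := (t %% n).

Lemma dec_lt t : t < n * n * n -> [/\ dec_u t < n, dec_v t < n & dec_x t < n].
Proof.
move=> h; have n0 : 0 < n by case: n h.
by rewrite ltn_divLR ?muln_gt0 ?n0 // mulnA h !ltn_mod.
Qed.

Lemma dec_surj u v x : u < n -> v < n -> x < n ->
  exists2 t, t < n * n * n & [/\ dec_u t = u, dec_v t = v & dec_x t = x].
Proof.
move=> hu hv hx; have n0 : 0 < n by apply: leq_trans hu.
have h1 : v * n + x < n * n by nia.
exists (u * (n * n) + (v * n + x)); first by nia.
split.
- by rewrite divnMDl ?muln_gt0 ?n0 // divn_small ?addn0.
- by rewrite mulnA addnA -mulnDl divnMDl // divn_small ?addn0 // modnMDl modn_small.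
- by rewrite mulnA addnA -mulnDl modnMDl modn_small.
Qed.

Lemma matching_ext f g : f =1 g -> matching n R f -> matching n R g.
Proof. by move=> e h x hx; have := h x hx; rewrite !e. Qed.

Lemma covered_ext f g : f =1 g -> covered n f = covered n g.
Proof. by move=> e; apply: eq_count => x /=; rewrite e. Qed.

(** After a change in the middle of a sweep the triples that failed earlier say nothing any more. So
    either the matching is still [f0] and all triples so far fail for it, or [f0] was augmentable
    and only the gain in coverage is recorded. *)
Definition sweep_inv (f0 : nat -> nat) (k : nat) (s : state) : Prop :=
  matching n R (s aMate) /\
  ((s aMate = f0 /\ forall t, t < k -> ~~ augmenting R f0 (dec_u t) (dec_v t) (dec_x t)) \/
   (~ unaugmentable n R f0 /\ covered n f0 < covered n (s aMate))).

Lemma match_try_wp f0 k s :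
  k < n * n * n -> s cT 0 = k -> sweep_inv f0 k s ->
  wp match_try 8 (sweep_inv f0 k.+1) s.
Proof.
move=> hk ck [hm hor].
have [hu hv hx] := dec_lt hk.
have small x : x < n -> x < 2 ^ b by move=> h; apply: (b_small bn); lia.
apply: wp_set_seq; rewrite /= ?updE /= ck; first exact: small.
apply: wp_set_seq; rewrite /= ?updE /= ck; first exact: small.
apply: wp_set_seq; rewrite /= ?updE /= ck; first exact: small.
set s1 := upd (upd _ _ _ _) _ _ _.
have m1 : matching n R (s1 aMate) by exact: hm.
have c1 := mate_condE n R s1; apply: wp_if => hc; last first.
  split=> //; case: hor => [[e h]|]; last by right.
  left; split=> // t; rewrite ltnS leq_eqVlt => /orP[/eqP ->|/h //].
  by rewrite -e; move: c1; rewrite hc => /esym/negbT; apply.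
have {}c1 : augmenting R (s aMate) (dec_u k) (dec_v k) (dec_x k).
  by rewrite hc in c1; exact: esym c1.
have fx : s aMate (dec_x k) < n by case: (hm _ hx).
apply: wp_set_seq; rewrite /= ?updE /=; first exact: small.
apply: wp_set_seq; rewrite /= ?updE /=; first exact: small.
apply: wp_set_seq; rewrite /= ?updE /=; first exact: small.
apply: wp_set; rewrite /= ?updE /=; first exact: small.
rewrite if_same.
set g := (X in sweep_inv _ _ X).
have eg : augment (s aMate) (dec_u k) (dec_v k) (dec_x k) =1 g aMate.
  by move=> y; rewrite /g !updE.
split; first by apply: matching_ext eg _; apply: augment_matching.
right; rewrite -(covered_ext eg).
have lt := covered_augment Rirr hm hu hv hx c1.
case: hor => [[e h]|[h1 h2]]; last by split=> //; apply: ltn_trans lt.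
by rewrite -e; split=> // h0; have := h0 _ _ _ hu hv hx; rewrite c1.
Qed.

Lemma match_sweep_wp s it :
  matching n R (s aMate) -> unaugmentable n R (s aMate) \/ it <= covered n (s aMate) ->
  wp match_sweep (n * n * n * 9).+1
     (fun s' => matching n R (s' aMate) /\
        (unaugmentable n R (s' aMate) \/ it.+1 <= covered n (s' aMate))) s.
Proof.
move=> hm hor.
have h : wp match_sweep (n * n * n * 9).+1 (sweep_inv (s aMate) (n * n * n)) s.
  apply: wp_for => //.
  - by apply: (b_cube bn); rewrite !expnS expn0; nia.
  - by split=> //; left.
  - by move=> k s' hk ck _; apply: match_try_wp.
apply: wp_weaken h _ _ => // s' _ [hm' h]; split=> //.
case: h => [[e h]|[h1 h2]].
  left; rewrite e => u v x hu hv hx.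
  have [t ht [<- <- <-]] := dec_surj hu hv hx; exact: h.
by right; case: hor => // hor; apply: leq_ltn_trans h2.
Qed.

Lemma match_prog_wp s :
  wp match_prog ((n * 2).+1 + ((n + 1) * (n * n * n * 9).+2).+1)
     (fun s' => matching n R (s' aMate) /\ unaugmentable n R (s' aMate)) s.
Proof.
apply: (@wp_seq _ _ _ _ _ _ _ (fun s' => forall x, x < n -> s' aMate x = x)).
  apply: (wp_for (I := fun k s' => forall x, x < k -> s' aMate x = x)) => //.
  - by apply: (b_small bn); lia.
  - move=> k s' hk ck _ ih; apply: wp_set; rewrite /= ck.
      by apply: (b_small bn); lia.
    move=> x; rewrite ltnS leq_eqVlt updE /=; case: eqP => [-> _ //|_]; exact: ih.
move=> s1 _ h1.
pose J it s' := matching n R (s' aMate) /\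
  (unaugmentable n R (s' aMate) \/ it <= covered n (s' aMate)).
have h : wp (PFor cI (TSize + 1)%trm match_sweep) ((n + 1) * (n * n * n * 9).+2).+1 (J (n + 1)) s1.
  apply: wp_for => //.
  - by apply: (b_small bn); lia.
  - by split; [move=> x hx; rewrite !h1 // eqxx|right].
  - by move=> k s' _ _ _ [hm hor]; apply: match_sweep_wp.
apply: wp_weaken h _ _ => // s' _ [hm [h|h]]; split=> //.
by have := covered_le n (s' aMate); lia.
Qed.

End Match.

(** * Roles and weights of the pairs *)

Section Pairs.

Variables (n : nat) (R : rel nat) (b : nat).
Hypothesis Rb : forall x y, R x y -> (x < n) && (y < n).
Hypothesis Rirr : irreflexive R.
Hypothesis Rtr : transitive R.
Hypothesis bn : 3 * n + 8 <= b.

Local Notation wp := (wp n R b).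

Variable f : nat -> nat.
Hypothesis hf : matching n R f.

Local Notation lows k := [seq x <- iota 0 k | R x (f x)].
Local Notation lower := (lower R f).
Local Notation pair_index := (pair_index n R f).
Local Notation m := (size (lowers n R f)).

Lemma size_lows k : k <= n -> size (lows k) <= m.
Proof.
move=> hk; rewrite /lowers -(subnKC hk) iotaD filter_cat size_cat; exact: leq_addr.
Qed.

Lemma size_lows_succ k : size (lows k.+1) = R k (f k) + size (lows k).
Proof.
rewrite -addn1 iotaD filter_cat size_cat /= add0n addnC.
by case: (R k (f k)).
Qed.

(** This follows from 3 < 4 and 2m <= n. *)
Lemma pow3_pairs k : k <= m -> 3 ^ k <= 2 ^ n.
Proof.
move=> hk; have := double_lowers Rirr Rtr hf; set c := count _ _ => e.
apply: leq_trans (_ : 2 ^ k.*2 <= _); last first.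
  by rewrite leq_exp2l //; clear -hk e; lia.
by case: (posnP k) => [->|k0] //; rewrite -mul2n expnM leq_exp2r.
Qed.

Lemma lower_rel y : y < n -> matched f y -> lower y < n /\ R (lower y) (f (lower y)).
Proof. by move=> hy my; have /lowers_lt := lower_mem hf hy my. Qed.

Lemma index_lowers k : k < n -> R k (f k) -> index k (lowers n R f) = size (lows k).
Proof.
move=> hk h;
  have -> : lowers n R f = lows k ++ k :: [seq x <- iota k.+1 (n - k.+1) | R x (f x)].
  rewrite /lowers -{1}(subnKC hk) addSnnS iotaD filter_cat /= add0n h.
  by congr (_ ++ _ :: [seq x <- iota _ _ | _]).
by rewrite index_cat mem_filter mem_iota ltnn !andbF /= eqxx addn0.
Qed.

(** Both ends of a pair receive their entries when the loop meets the lower one. *)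
Definition pairs_inv (k : nat) (s : state) : Prop :=
  [/\ s aPow 0 = 3 ^ size (lows k), s aPairs 0 = size (lows k),
      forall y, y < n -> s aRole y = if matched f y && (lower y < k) then role R f y else 0 &
      forall y, y < n -> s aWeight y = if matched f y && (lower y < k) then 3 ^ pair_index y else 0].

Lemma pairs_prog_wp s :
  s aMate =1 f -> (forall x, s aRole x = 0) -> (forall x, s aWeight x = 0) ->
  wp pairs_prog (2 + (n * 8).+1)
     (fun s' => [/\ s' aPow 0 = 3 ^ m, s' aPairs 0 = m,
        forall y, y < n -> s' aRole y = role R f y &
        forall y, y < n -> s' aWeight y = weight f pair_index y]) s.
Proof.
move=> sf sr sw.
have small x : x <= n -> x < 2 ^ b by move=> h; apply: (b_small bn); lia.
apply: wp_set_seq; first by apply: (b_small bn); rewrite /=; lia.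
apply: wp_set_seq; first by apply: (b_small bn); rewrite /=; lia.
set s1 := upd _ _ _ _.
have lowlt y : y < n -> matched f y -> lower y < n by move=> hy my; case: (lower_rel hy my).
apply: (@wp_weaken _ _ _ _ _ _ (pairs_inv n) _ _ _ (leqnn _)); last first.
  move=> s' _ [h1 h2 h3 h4]; split=> // y hy.
    rewrite h3 //; have [my|my] := boolP (matched f y); first by rewrite lowlt.
    by apply/esym/eqP; rewrite -leqn0 leqNgt (role_gt0 Rirr hf).
  by rewrite h4 // /weight; have [my|//] := boolP (matched f y); rewrite lowlt.
apply: wp_for => //; first exact: small.
  split=> // y hy; rewrite ltn0 andbF /s1 !updE; [exact: sr|exact: sw].
move=> k s' hk ck fr [h1 h2 h3 h4].
have sf' y : s' aMate y = f y by rewrite (fr aMate) // /s1 !updE /= sf.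
have [fk ffk ck'] := hf hk.
apply: wp_if => /=; rewrite ck sf' => hc; last first.
  have {hc} hc : R k (f k) = false by case: (R k (f k)) hc.
  have e y : y < n -> matched f y && (lower y < k.+1) = matched f y && (lower y < k).
    move=> hy; have [my|//] := boolP (matched f y); rewrite /= ltnS leq_eqVlt.
    by case: eqP => // ek; have [_] := lower_rel hy my; rewrite ek hc.
  by split; rewrite ?size_lows_succ ?hc // => y hy; rewrite e ?h3 ?h4.
have {hc} hc : R k (f k) by case: (R k (f k)) hc.
have mk : matched f k by rewrite (matched_R Rirr hf) // hc.
have nkf : (k == f k) = false by rewrite eq_sym; apply: negbTE.
have sm : (size (lows k)).+1 <= m by have := size_lows hk; rewrite size_lows_succ hc.
have e y : y < n -> matched f y && (lower y < k.+1) =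
    [|| y == k, y == f k | matched f y && (lower y < k)].
  move=> hy; have [->|nyk] /= := eqVneq y k; first by rewrite mk /lower hc ltnSn.
  have [->|nyf] /= := eqVneq y (f k).
    by rewrite (matched_f hf) // mk (lower_f Rirr Rtr hf) // /lower hc ltnSn.
  have [my|//] := boolP (matched f y); rewrite /= ltnS leq_eqVlt.
  case: eqP => // ek; move: ek nyk nyf; rewrite /lower; have [_ ffy _] := hf hy.
  by case: ifP => [_ -> |_ <-]; rewrite ?eqxx // ffy eqxx.
have nlow : lower k = k by rewrite /lower hc.
have nlowf : lower (f k) = k by rewrite (lower_f Rirr Rtr hf).
have pik : pair_index k = size (lows k) by rewrite pair_indexE nlow index_lowers.
have pif : pair_index (f k) = size (lows k) by rewrite (pair_index_f Rirr Rtr hf).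
have p3 : 3 ^ size (lows k) * 3 < 2 ^ b.
  by apply: (b_exp bn); rewrite -expnSr; have := pow3_pairs sm; nia.
have p3' : 3 ^ size (lows k) < 2 ^ b by apply: leq_ltn_trans p3; rewrite leq_pmulr.
apply: wp_set_seq; rewrite /= ?updE /= ?ck ?sf' ?h1 ?h2; first by apply: (b_small bn); lia.
apply: wp_set_seq; rewrite /= ?updE /= ?ck ?sf' ?h1 ?h2; first by apply: (b_small bn); lia.
apply: wp_set_seq; rewrite /= ?updE /= ?ck ?sf' ?h1 ?h2 //.
apply: wp_set_seq; rewrite /= ?updE /= ?ck ?sf' ?h1 ?h2 //.
apply: wp_set_seq; rewrite /= ?updE /= ?ck ?sf' ?h1 ?h2 //.
apply: wp_set; rewrite /= ?updE /= ?ck ?sf' ?h1 ?h2.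
  have mn : m <= n by rewrite size_filter -[X in _ <= X](size_iota 0) count_size.
  by apply: (b_small bn); move: (leq_trans sm mn); rewrite addn1 => h;
    apply: leq_trans h (leq_addr _ _).
split; rewrite ?updE /= ?size_lows_succ ?hc ?add1n ?expnSr ?addn1 // => y hy;
  rewrite !updE /= e //.
  have [->|nyf] := eqVneq y (f k).
    by rewrite orbT (role_f Rirr Rtr hf) // /role hc.
  have [->|nyk] := eqVneq y k; first by rewrite /role hc.
  by rewrite /= h3.
have [->|nyf] := eqVneq y (f k); first by rewrite orbT pif.
have [->|nyk] := eqVneq y k; first by rewrite pik.
by rewrite /= h4.
Qed.

End Pairs.

(** * The list of candidate sets *)

Section SubsetsList.

Variables (n : nat) (R : rel nat) (b : nat).
Hypothesis bn : 3 * n + 8 <= b.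

Local Notation wp := (wp n R b).

Variables (U : pred nat) (m : nat).
Hypothesis mn : m <= n.

Local Notation K := m./2.
Local Notation subs a := (subsets U K a).

Definition stored (s : state) (l : seq (nat * nat)) : Prop :=
  s aLen 0 = size l /\
  forall k, k < size l ->
    s aMask k = (nth (0, 0) l k).1 /\ s aCard k = (nth (0, 0) l k).2.

Lemma add_point_rcons a l p :
  add_point K a (rcons l p) =
  if p.2 < K then rcons (add_point K a l) (p.1 + 2 ^ a, p.2.+1) else add_point K a l.
Proof. by rewrite /add_point filter_rcons; case: ifP; rewrite ?map_rcons. Qed.

Lemma subsets_step_wp a k s :
  a < n -> U a -> k < size (subs a) -> s cK 0 = k -> s aPairs 0 = m ->
  s aBit 0 = 2 ^ a -> stored s (subs a ++ add_point K a (take k (subs a))) ->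
  wp (If (!aPairs %/ 2) - aCard @[!cK] Then
        PSet aMask (!aLen) (aMask @[!cK] + !aBit);;
        PSet aCard (!aLen) (aCard @[!cK] + 1);;
        PSet aLen 0 (!aLen + 1)
      End)%prg 4
    (fun s' => stored s' (subs a ++ add_point K a (take k.+1 (subs a)))) s.
Proof.
move=> ha Ua hk ck sm sb [hl hs].
set l := subs a in hk hl hs *; set p := nth (0, 0) l k.
have [hm hc] : s aMask k = p.1 /\ s aCard k = p.2.
  have [|-> ->] := hs k; first by rewrite size_cat ltn_addr.
  by rewrite nth_cat hk.
have pl : p \in l by apply: mem_nth.
have [p1 p2] := subsets_lt pl.
rewrite (take_nth (0, 0)) // add_point_rcons -/p.
apply: wp_if => /=; rewrite ck sm hc divn2 => h; last first.
  by rewrite ifF //; apply/negbTE; rewrite -leqNgt -subn_eq0 h.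
rewrite ifT; last by rewrite ltnNge -subn_eq0.
set l' := l ++ add_point K a (take k l) in hl hs *.
have e2 : 2 ^ a + 2 ^ a <= 2 ^ n.
  by rewrite addnn -mul2n -expnS leq_exp2l.
(* The list so far lacks the set that is about to be appended, so it is strictly shorter than
   [subs a.+1]. *)
have sl : size l' < 2 ^ n.
  apply: leq_trans (_ : size (subs a.+1) <= _); last first.
    by apply: leq_trans (size_subsets _ _ _) _; rewrite leq_exp2l.
  rewrite /= Ua -/l -{2}(cat_take_drop k l) /l' !size_cat -addnS leq_add2l.
  rewrite /add_point filter_cat map_cat size_cat -addn1 leq_add2l (drop_nth (0, 0)) //=.
  by rewrite -/p ifT // ltnNge -subn_eq0.
have bb x : x <= 2 ^ n -> x < 2 ^ b.
  by move=> hx; apply: (b_exp bn); apply: leq_trans hx (leq_pmulr _ _); rewrite addn2.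
apply: wp_set_seq; rewrite /= ?updE /= ck ?hm ?sb.
  by apply: bb; apply: leq_trans e2; rewrite leq_add2r ltnW.
apply: wp_set_seq; rewrite /= ?updE /= ck ?hc.
  have pn : p.2 <= n by apply: leq_trans p2 _; lia.
  by apply: (b_small bn); rewrite leq_add.
apply: wp_set; rewrite /= ?updE /= hl; first by apply: bb; rewrite addn1.
split; first by rewrite updE /= -rcons_cat size_rcons addn1.
move=> i; rewrite -rcons_cat size_rcons ltnS !updE /= nth_rcons => hi.
have [->|ni] := eqVneq i (size l'); first by rewrite ltnn addn1.
have {}hi : i < size l' by rewrite ltn_neqAle ni.
by rewrite hi; apply: hs.
Qed.

Lemma subsets_prog_wp s :
  s aPairs 0 = m -> (forall x, x < n -> (s aRole x == 0) = U x) ->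
  wp subsets_prog (4 + (n * (size (subs n) * 5).+4).+1)
     (fun s' => stored s' (subs n)) s.
Proof.
move=> sm sU.
have small x : x <= n + 4 -> x < 2 ^ b by exact: b_small.
do 4 (apply: wp_set_seq; first by apply: small; rewrite /=; lia).
set s1 := upd _ _ _ _.
pose I a s' := stored s' (subs a) /\ s' aBit 0 = 2 ^ a.
apply: (@wp_weaken _ _ _ _ _ _ (I n) _ _ _ (leqnn _)); last by move=> s' _ [].
apply: wp_for => //; first by apply: small; lia.
  by split; [split=> //= k; rewrite ltnS leqn0 => /eqP ->|].
move=> a s' ha ca fr [hs hb].
have sm' : s' aPairs 0 = m by rewrite (fr aPairs).
have sU' x : x < n -> (s' aRole x == 0) = U x by move=> hx; rewrite (fr aRole) //;
  apply: sU.
have e2 : 2 ^ a * 2 < 2 ^ b.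
  apply: (b_exp bn); rewrite mulnC -expnS.
  by apply: leq_trans (leq_pmulr _ _); rewrite ?addn2 // leq_exp2l.
have mono x : x <= n -> size (subs x) <= size (subs n) by exact: size_subsets_mono.
apply: (@wp_le _ _ _ ((size (subs n) * 5).+2 + 1)); last by rewrite addn1.
apply: (@wp_seq _ _ _ _ _ _ _ (fun s2 => stored s2 (subs a.+1))); last first.
  move=> s2 fr2 hs2; apply: wp_set; first by rewrite /= fr2 // hb.
  by split; [|rewrite updE /= fr2 // hb expnS mulnC].
apply: (@wp_weaken _ _ _ _ ((size (subs a) * 5).+2) _ (fun s2 => stored s2 (subs a.+1))) => //; last first.
  by rewrite !ltnS leq_mul2r mono ?orbT // ltnW.
apply: wp_if => /=; rewrite ca => h; last first.
  have -> : U a = false by rewrite -sU' //; case: (s' aRole a) h.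
  exact: hs.
have Ua : U a by rewrite -sU' //; case: (s' aRole a) h.
rewrite Ua -{3}(take_size (subs a)).
pose J k s2 := stored s2 (subs a ++ add_point K a (take k (subs a))).
apply: (wp_for (I := J)) => //.
- by case: hs.
- case: hs => hl _; apply: (b_exp bn).
  apply: leq_trans (size_subsets _ _ _) _; apply: leq_trans (leq_pmulr _ _);
    rewrite ?addn2 //.
  by rewrite leq_exp2l // ltnW.
- by rewrite /J take0 /add_point /= cats0.
- move=> k s2 hk ck fr2 hJ; apply: subsets_step_wp => //.
    by rewrite (fr2 aPairs).
  by rewrite (fr2 aBit).
Qed.

End SubsetsList.

(** * One row of the table *)

Section Rows.

Variables (n : nat) (R : rel nat) (b : nat).
Hypothesis Rb : forall x y, R x y -> (x < n) && (y < n).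
Hypothesis Rirr : irreflexive R.
Hypothesis Rtr : transitive R.
Hypothesis bn : 3 * n + 8 <= b.

Local Notation wp := (wp n R b).

Variable f : nat -> nat.
Hypothesis hf : matching n R f.
Hypothesis hfa : unaugmentable n R f.

Local Notation q := (pair_index n R f).
Local Notation m := (size (lowers n R f)).
Local Notation w := (weight f q).
Local Notation digit := (digit f q).
Local Notation inside := (inside R f q).
Local Notation avail := (avail n R f q).
Local Notation addable := (addable n R f q).

Variable T : pred nat.
Local Notation sound := (sound n R f q T).

Definition env (s : state) : Prop :=
  [/\ forall y, y < n -> s aRole y = role R f y,
      forall y, y < n -> s aWeight y = w y,
      forall y, y < n -> ~~ matched f y -> s aStart y = T y &
      s aPow 0 = 3 ^ m].

Let small x : x <= n + 4 -> x < 2 ^ b. Proof. exact: b_small. Qed.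

Lemma row_digits_wp s : env s ->
  wp row_digits (n * 3).+1
    (fun s' => forall x, x < n ->
       s' aDigit x = digit (s cD 0) x /\ s' aInside x = inside (s cD 0) x) s.
Proof.
case=> er ew _ _; set D := s cD 0.
pose I k (s' : state) := forall x, x < k -> s' aDigit x = digit D x /\ s' aInside x = inside D x.
apply: (wp_for (I := I)) => //; first by apply: small; lia.
move=> k s' hk ck fr ih.
have cD' : s' cD 0 = D by rewrite (fr cD).
have hr : s' aRole k = role R f k by rewrite (fr aRole) // er.
have hw : s' aWeight k = w k by rewrite (fr aWeight) // ew.
have l3 : digit D k < 3 by apply: digit_lt3.
apply: wp_set_seq; rewrite /= ?updE /= ck cD' hw; first by apply: small;
  rewrite -/(digit D k); lia.
apply: wp_set; rewrite /= ?updE /= ck hr eqxx -/(digit D k); first by apply: small; lia.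
have -> : 1 - (role R f k - digit D k) = inside D k.
  by rewrite insideE -subn_eq0; case: (role R f k - digit D k) => [//|j];
    rewrite subSS sub0n.
move=> x; rewrite ltnS leq_eqVlt !updE /=; case: eqP => [-> _ //|_]; exact: ih.
Qed.

Lemma row_flags_wp D s : env s -> s cD 0 = D ->
  (forall x, x < n -> s aDigit x = digit D x /\ s aInside x = inside D x) ->
  wp row_flags (n * (n * 3 + 5).+1).+1
    (fun s' => forall y, y < n -> s' aAvail y = avail D y /\ s' aAddable y = addable D y) s.
Proof.
case=> er _ _ _ cDs hd.
pose I k (s' : state) := forall y, y < k -> s' aAvail y = avail D y /\ s' aAddable y = addable D y.
apply: (wp_for (I := I)) => //; first by apply: small; lia.
move=> y s1 hy cy fr1 ih.
apply: (@wp_le _ _ _ ((n * 3).+1 + 2).+2); last by rewrite addSn !addnS addn0.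
do 2 (apply: wp_set_seq; rewrite /= ?updE /= ?cy; first by apply: small; lia).
set s2 := upd _ _ _ _.
pose J k (s' : state) := I y s' /\
  s' aAddable y = all (fun x => R x y ==> inside D x) (iota 0 k) /\
  s' aAvail y = all (fun x => R y x ==> ~~ inside D x) (iota 0 k).
apply: (@wp_seq _ _ _ _ _ _ _ (J n)).
  apply: (wp_for (I := J)) => //; first by apply: small; lia.
    split; last by rewrite /s2 !updE /= eqxx.
    by move=> x hx; rewrite /s2 !updE /= (ltn_eqF hx); apply: ih.
  move=> k s3 hk ck fr3 [h1 [h2 h3]].
  have [_ hi] := hd k hk.
  have cy3 : s3 cY 0 = y by rewrite (fr3 cY) // /s2 !updE.
  have hi3 : s3 aInside k = inside D k.
    by rewrite (fr3 aInside) // /s2 !updE /= (fr1 aInside).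
  have b1 (c d : bool) : c * d <= n + 4 by case: c; case: d; lia.
  have e1 : s3 aAddable y * (1 - R k y * (1 - s3 aInside k)) =
      all (fun x => R x y ==> inside D x) (iota 0 k.+1).
    rewrite h2 hi3 -(addn1 k) iotaD all_cat /= andbT -mulnb add0n; congr (_ * _).
    by case: (R k y); case: (inside D k).
  have e2 : s3 aAvail y * (1 - R y k * s3 aInside k) =
      all (fun x => R y x ==> ~~ inside D x) (iota 0 k.+1).
    rewrite h3 hi3 -(addn1 k) iotaD all_cat /= andbT -mulnb add0n; congr (_ * _).
    by case: (R y k); case: (inside D k).
  have bb (c : bool) : c < 2 ^ b by apply: small; case: c; lia.
  apply: wp_set_seq; rewrite /= cy3 ck e1 //.
  apply: wp_set; rewrite /= ?updE /= cy3 ck e2 //.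
  split; last by rewrite !updE /= eqxx.
  by move=> x hx; rewrite !updE /= (ltn_eqF hx); apply: h1.
move=> s3 fr3 [h1 [h2 h3]].
have cy3 : s3 cY 0 = y by rewrite fr3 // /s2 !updE.
have hr3 : s3 aRole y = role R f y by rewrite fr3 // /s2 !updE /= (fr1 aRole) // er.
have [hd3 _] := hd y hy.
have hd4 : s3 aDigit y = digit D y by rewrite fr3 // /s2 !updE /= (fr1 aDigit).
have bb (c : bool) : c < 2 ^ b by apply: small; case: c; lia.
have e1 : (1 - s3 aRole y) * (s3 aAddable y * s3 aAvail y) = avail D y.
  rewrite hr3 h2 h3 !mulnb; have -> : 1 - role R f y = ~~ matched f y.
    by rewrite -(role_gt0 Rirr hf hy); case: (role R f y).
  by rewrite mulnb.
have e2 : s3 aAddable y * (s3 aDigit y + 1 == s3 aRole y) = addable D y.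
  by rewrite hr3 hd4 h2 addn1 mulnb.
apply: wp_set_seq; rewrite /= cy3 e1 //.
apply: wp_set; rewrite /= ?updE /= cy3 e2 //.
move=> x; rewrite ltnS leq_eqVlt !updE /=; case: eqP => [-> _ //|_ /= hx]; exact: h1.
Qed.

Let q_f x : x < n -> q (f x) = q x.
Proof. exact: pair_index_f. Qed.

Let q_inj x y : x < n -> y < n -> matched f x -> matched f y ->
  q x = q y -> y = x \/ y = f x.
Proof. exact: pair_index_inj. Qed.

Definition cell (F : nat -> nat) D z := F (D * (n + 1) + z).

(** Soundness is required of all rows at every moment, because transitions write ahead into rows not
    yet processed. The bound on the values keeps them within a word. *)
Definition good (F : nat -> nat) : Prop :=
  [/\ forall D z, D < 3 ^ m -> z <= n -> 0 < cell F D z -> sound D z (cell F D z).-1,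
      0 < cell F 0 n & forall i, F i <= n + 1].

Definition closed_follower F D z a : Prop :=
  0 < cell F D z -> avail D a -> ~~ T a -> R z a -> cell F D z < cell F D a.

Definition closed_matched F D z c : Prop :=
  0 < cell F D z -> addable D c ->
  cell F D z + R z c <= cell F (D + w c) c /\
  forall a, a < n -> avail D a -> T a -> R a c ->
    cell F D z + (1 + R z a) <= cell F (D + w c) c.

Lemma entry_inj D z D' z' : z <= n -> z' <= n ->
  D * (n + 1) + z = D' * (n + 1) + z' -> D = D' /\ z = z'.
Proof.
rewrite !addn1 => hz hz' e; split.
  by move: (congr1 (divn^~ n.+1) e); rewrite !divnMDl // !divn_small ?addn0.
by move: (congr1 (modn^~ n.+1) e); rewrite !modnMDl !modn_small.
Qed.

Lemma good_max F D z v F' : good F -> z <= n -> 0 < v -> sound D z v.-1 ->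
  (forall i, F' i = if i == D * (n + 1) + z then maxn (F i) v else F i) ->
  good F' /\ (forall i, F i <= F' i).
Proof.
move=> [g1 g2 g3] hz v0 hv e.
have mono i : F i <= F' i by rewrite e; case: ifP => // _; rewrite leq_maxl.
split=> //; split.
- move=> D' z' hD hz'; rewrite /cell e; case: eqP => [/(entry_inj hz' hz)[eD ->]|_];
  last exact: g1.
  rewrite eD.
  by rewrite /maxn; case: (ltnP (F _) v) => [_ _ //|_ p]; apply: (g1 D z) => //;
    rewrite -eD.
- exact: leq_trans g2 (mono _).
- move=> i; rewrite e; case: eqP => // _; rewrite geq_max g3 /=.
  by have := sound_bound Rb hv; lia.
Qed.

Lemma row_followers_wp D s : env s -> s cD 0 = D -> D < 3 ^ m ->
  (forall y, y < n -> s aAvail y = avail D y :> nat) -> good (s aTable) ->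
  wp row_followers (n * n * 5).+1
    (fun s' => [/\ good (s' aTable), forall i, s aTable i <= s' aTable i,
       forall i, i < D * (n + 1) -> s' aTable i = s aTable i &
       forall z a, z < n -> a < n -> closed_follower (s' aTable) D z a]) s.
Proof.
case=> _ _ et _ cDs hD hav hg; set F := s aTable in hg *.
pose I k (s' : state) :=
  [/\ good (s' aTable), forall i, F i <= s' aTable i,
      forall i, s' aTable i != F i ->
        exists a, [/\ a < n, ~~ matched f a & i = D * (n + 1) + a] &
      forall t, t < k -> closed_follower (s' aTable) D (t %/ n) (t %% n)].
apply: (@wp_weaken _ _ _ _ _ _ (I (n * n)) _ _ _ (leqnn _)); last first.
  move=> s' _ [h1 h2 h3 h4]; split=> // [i hi|z a hz ha].
    by apply/eqP; apply: contraTT hi => /h3[a [_ _ ->]]; rewrite -leqNgt leq_addr.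
  have := h4 (z * n + a); rewrite divnMDl ?divn_small ?addn0 ?modnMDl ?modn_small //;
    last by lia.
  by apply; nia.
apply: wp_for => //; first by apply: (b_cube bn); rewrite !expnS expn0; nia.
  by split=> // i; rewrite eqxx.
move=> k s1 hk ck fr [h1 h2 h3 h4].
have n0 : 0 < n by case: n hk.
set z := k %/ n; set a := k %% n.
have hz : z < n by rewrite ltn_divLR.
have ha : a < n by rewrite ltn_mod.
apply: wp_set_seq; rewrite /= ?updE /= ck -/z; first by apply: small; lia.
apply: wp_set_seq; rewrite /= ?updE /= ck -/a; first by apply: small; lia.
set s2 := upd _ _ _ _.
have u2 : s2 aU 0 = z by [].
have v2 : s2 aV 0 = a by [].
have tab2 : s2 aTable = s1 aTable by [].
have cD2 : s2 cD 0 = D by rewrite /s2 !updE /= (fr cD).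
have av2 y : y < n -> s2 aAvail y = avail D y :> nat.
  by move=> hy; rewrite /s2 !updE /= (fr aAvail) // hav.
have st2 y : y < n -> ~~ matched f y -> s2 aStart y = T y.
  by move=> hy my; rewrite /s2 !updE /= (fr aStart) // et.
have hc : (teval n R s2 (aTable @[entry (!cD) (!aU)] * aAvail @[!aV] * (1 - aStart @[!aV])
        * TRel (!aU) (!aV))%trm != 0) =
    [&& 0 < cell (s1 aTable) D z, avail D a, ~~ T a & R z a].
  rewrite /= cD2 u2 v2 av2 // -lt0n !muln_gt0 lt0b.
  case av: (avail D a); last by rewrite !andbF.
  have ma : ~~ matched f a by case/and3P: av.
  by rewrite st2 // andbT -andbA; congr (_ && _); case: (T a); case: (R z a).
apply: wp_if => hc'; rewrite hc' /= in hc; last first.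
  split=> // t; rewrite ltnS leq_eqVlt => /orP[/eqP ->|]; last exact: h4.
  by move=> p1 p2 p3 p4; move: hc; rewrite -/z -/a p1 p2 p3 p4.
move/esym: hc => /and4P[p1 p2 p3 p4].
have ma : ~~ matched f a by case/and3P: p2.
have va : cell (s1 aTable) D z <= n + 1 by case: h1 => _ _ h; apply: h.
have vb : cell (s1 aTable) D a <= n + 1 by case: h1 => _ _ h; apply: h.
apply: wp_set; rewrite /= cD2 u2 v2 tab2 -!/(cell _ _ _).
  by apply: small; rewrite geq_max; lia.
set s3 := upd _ _ _ _.
set v := cell (s1 aTable) D z + 1.
have eF i : s3 aTable i = if i == D * (n + 1) + a then maxn (s1 aTable i) v else s1 aTable i.
  by rewrite /s3 !updE /=; case: eqP => [->|].
have sv : sound D a v.-1.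
  rewrite /v addn1 /= -(prednK p1); apply: (sound_follower Rb Rirr hfa) p2 p3 p4 => //.
  by case: h1 => g _ _; apply: g => //; apply: ltnW.
have [g3 mono] := good_max h1 (ltnW ha) (ltn_addl _ (ltn0Sn _) : 0 < v) sv eF.
have same z' a' : avail D a' -> R z' a' -> cell (s3 aTable) D z' = cell (s1 aTable) D z'.
  move=> va' ra'; rewrite /cell eF ifF //; apply/eqP.
  have /andP[hz' _] := Rb ra'.
  move=> /(entry_inj (ltnW hz') (ltnW ha))[_ ez].
  by move: ra'; rewrite ez (unmatched_anti Rb Rirr hfa) //; case/and3P: va'.
split=> //.
- by move=> i; apply: leq_trans (h2 i) (mono i).
- move=> i; rewrite eF; have [-> _|_] := eqVneq i (D * (n + 1) + a); last exact: h3.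
  by exists a.
- move=> t; rewrite ltnS leq_eqVlt => /orP[/eqP ->|ht].
    move=> _ _ _ _; rewrite -/z -/a (same z a) // /cell eF eqxx.
    by apply: leq_trans (leq_maxr _ _);
      rewrite (_ : v = (cell (s1 aTable) D z).+1) ?ltnSn // /v addn1.
  move=> q1 q2 q3 q4; rewrite (same _ _ q2 q4) in q1 *.
  exact: leq_trans (h4 t ht q1 q2 q3 q4) (mono _).
Qed.

Lemma entry_lt D z : z <= n -> D * (n + 1) + z < D.+1 * (n + 1).
Proof. by rewrite mulSnr ltn_add2l addn1 ltnS. Qed.

(** The entries read are fixed once their row is done, and the entries they are compared with can
    only grow; so the work on later rows preserves closure. *)
Lemma closed_follower_mono F F' D z a : z <= n ->
  (forall i, i < D.+1 * (n + 1) -> F' i = F i) -> (forall i, F i <= F' i) ->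
  closed_follower F D z a -> closed_follower F' D z a.
Proof.
move=> hz e le h; rewrite /closed_follower {1 2}/cell e ?entry_lt // => p1 p2 p3 p4.
exact: leq_trans (h p1 p2 p3 p4) (le _).
Qed.

Lemma closed_matched_mono F F' D z c : z <= n ->
  (forall i, i < D.+1 * (n + 1) -> F' i = F i) -> (forall i, F i <= F' i) ->
  closed_matched F D z c -> closed_matched F' D z c.
Proof.
move=> hz e le h; rewrite /closed_matched {1 2 4}/cell e ?entry_lt // => p1 p2.
have [h1 h2] := h p1 p2; split; first exact: leq_trans h1 (le _).
by move=> a q1 q2 q3 q4; apply: leq_trans (h2 a q1 q2 q3 q4) (le _).
Qed.

Lemma good_ext F F' : F =1 F' -> good F -> good F'.
Proof.
by move=> e [h1 h2 h3]; split; [move=> D z|..]; rewrite /cell -?e //;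
  [exact: h1|move=> i; rewrite -e].
Qed.

Definition gain_inv (D z c k g : nat) : Prop :=
  [/\ g = R z c \/ exists a, [/\ a < n, avail D a, T a, R a c & g = 1 + R z a],
      R z c <= g &
      forall a, a < k -> avail D a -> T a -> R a c -> 1 + R z a <= g].

Lemma gain_wp (D z c : nat) (s : state) : (forall y, y < n -> ~~ matched f y -> s aStart y = T y) ->
  (forall y, y < n -> s aAvail y = avail D y :> nat) ->
  s aU 0 = z -> s aV 0 = c -> s aGain 0 = R z c ->
  wp (For cX Below TSize Do
       If aAvail @[!cX] * aStart @[!cX] * TRel (!cX) (!aV) Then
         PSet aGain 0 (TMax (!aGain) (1 + TRel (!aU) (!cX)))
       End
     End)%prg (n * 3).+1 (fun s' => gain_inv D z c n (s' aGain 0)) s.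
Proof.
move=> hst hav hu hv hg.
apply: (wp_for (I := fun k s' => gain_inv D z c k (s' aGain 0))) => //.
- by apply: small; lia.
- by split; rewrite ?hg //; left.
move=> k s1 hk ck fr [h1 h2 h3].
have av1 : s1 aAvail k = avail D k by rewrite (fr aAvail) // hav.
have u1 : s1 aU 0 = z by rewrite (fr aU).
have v1 : s1 aV 0 = c by rewrite (fr aV).
have hc : (teval n R s1 (aAvail @[!cX] * aStart @[!cX] * TRel (!cX) (!aV))%trm != 0) =
    [&& avail D k, T k & R k c].
  rewrite /= ck av1 v1 -lt0n !muln_gt0 lt0b; case av: (avail D k) => //=.
  have mk : ~~ matched f k by case/and3P: av.
  by rewrite (fr aStart) // hst //; case: (T k); case: (R k c).
have g2 : s1 aGain 0 <= 2.
  case: h1 => [->|[a [_ _ _ _ ->]]]; first by case: (R z c).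
  by case: (R z a).
apply: wp_if => hc'; rewrite hc' /= in hc; last first.
  split=> // a; rewrite ltnS leq_eqVlt => /orP[/eqP ->|]; last exact: h3.
  by move=> p1 p2 p3; move: hc; rewrite p1 p2 p3.
move/esym: hc => /and3P[p1 p2 p3].
apply: wp_set; rewrite /= ?updE /= u1 ck.
  by apply: small; rewrite geq_max; case: (R z k); lia.
set g' := maxn _ _; have gg : s1 aGain 0 <= g' by exact: leq_maxl.
split.
- rewrite /g' /maxn; case: ltnP => _; last exact: h1.
  by right; exists k.
- exact: leq_trans gg.
- move=> a; rewrite ltnS leq_eqVlt => /orP[/eqP -> _ _ _|ha q1 q2 q3].
    exact: leq_maxr.
  exact: leq_trans (h3 a ha q1 q2 q3) gg.
Qed.

Lemma row_matched_wp D s : env s -> s cD 0 = D -> D < 3 ^ m ->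
  (forall y, y < n -> s aAvail y = avail D y :> nat) ->
  (forall y, y < n -> s aAddable y = addable D y :> nat) ->
  good (s aTable) ->
  wp row_matched ((n + 1) * n * (n * 3 + 7)).+1
    (fun s' => [/\ good (s' aTable), forall i, s aTable i <= s' aTable i,
       forall i, i < D.+1 * (n + 1) -> s' aTable i = s aTable i &
       forall z c, z <= n -> c < n -> closed_matched (s' aTable) D z c]) s.
Proof.
case=> _ ew et _ cDs hD hav had hg; set F := s aTable in hg *.
pose I k (s' : state) :=
  [/\ good (s' aTable), forall i, F i <= s' aTable i,
      forall i, i < D.+1 * (n + 1) -> s' aTable i = F i &
      forall t, t < k -> closed_matched (s' aTable) D (t %/ n) (t %% n)].
apply: (@wp_weaken _ _ _ _ _ _ (I ((n + 1) * n)) _ _ _ (leqnn _)); last first.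
  move=> s' _ [h1 h2 h3 h4]; split=> // z c hz hc.
  have := h4 (z * n + c); rewrite divnMDl ?divn_small ?addn0 ?modnMDl ?modn_small //;
    last by lia.
  by apply; nia.
have -> : n * 3 + 7 = (n * 3 + 6).+1 by rewrite !addnS.
apply: wp_for => //; first by apply: (b_cube bn); rewrite !expnS expn0; nia.
move=> k s1 hk ck fr [h1 h2 h3 h4].
have n0 : 0 < n by move: hk; case: (n) => //; rewrite muln0.
set z := k %/ n; set c := k %% n.
have hz : z <= n by rewrite -ltnS ltn_divLR // -(addn1 n).
have hc : c < n by rewrite ltn_mod.
apply: (@wp_le _ _ _ ((n * 3).+1 + 2).+3); last by rewrite !addnS addSn addn0.
apply: wp_set_seq; rewrite /= ?updE /= ck -/z; first by apply: small; lia.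
apply: wp_set_seq; rewrite /= ?updE /= ck -/c; first by apply: small; lia.
apply: wp_set_seq; rewrite /= ?updE /=; first by apply: small; case: (R z c); lia.
set s2 := upd _ _ _ _.
have tab2 : s2 aTable = s1 aTable by [].
apply: (wp_seq (gain_wp (D := D) (z := z) (c := c) _ _ _ _ _)) => //.
- by move=> y hy my; rewrite /s2 !updE /= (fr aStart) // et.
- by move=> y hy; rewrite /s2 !updE /= (fr aAvail) // hav.
move=> s3 fr3 [g1 g2 g3].
have cD3 : s3 cD 0 = D by rewrite fr3 // /s2 !updE /= (fr cD) // cDs.
have u3 : s3 aU 0 = z by rewrite fr3.
have v3 : s3 aV 0 = c by rewrite fr3.
have ad3 : s3 aAddable c = addable D c by rewrite fr3 // /s2 !updE /= (fr aAddable) // had.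
have w3 : s3 aWeight c = w c by rewrite fr3 // /s2 !updE /= (fr aWeight) // ew.
have tab3 i : s3 aTable i = s1 aTable i by rewrite fr3.
have hcond : (teval n R s3 (aTable @[entry (!cD) (!aU)] * aAddable @[!aV])%trm != 0) =
    (0 < cell (s1 aTable) D z) && addable D c.
  by rewrite /= cD3 u3 v3 ad3 tab3 -lt0n !muln_gt0 lt0b.
have good3 : good (s3 aTable) by apply: good_ext h1 => i; rewrite tab3.
have z_lt t : t < k -> t %/ n <= n.
  by move=> ht; rewrite -ltnS ltn_divLR // -(addn1 n); apply: ltn_trans ht hk.
apply: wp_if => hc'; rewrite hc' /= in hcond; last first.
  split=> // [i|i hi|t]; rewrite ?tab3 //; first exact: h3.
  rewrite ltnS leq_eqVlt => /orP[/eqP ->|ht].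
    by rewrite -/z -/c => p1 p2; move: hcond; rewrite p2 andbT /cell -tab3 p1.
  by apply: closed_matched_mono (h4 t ht); rewrite ?z_lt // => i; rewrite tab3.
move/esym: hcond => /andP[p1 p2].
have mc : matched f c by apply: addable_matched p2.
have w0 : 0 < w c by rewrite /weight mc expn_gt0.
set g := s3 aGain 0 in g1 g2 g3 *.
have gle : g <= 2.
  case: g1 => [->|[a [_ _ _ _ ->]]]; first by case: (R z c).
  by case: (R z a).
have le1 i : s1 aTable i <= n + 1 by case: h1.
have big2 : n + 3 < 2 ^ b by apply: small; lia.
apply: wp_set; rewrite /= cD3 u3 v3 w3 !tab3 -/g -!/(cell _ _ _).
  apply: leq_ltn_trans big2; rewrite geq_max !/cell; have := le1 (D * (n + 1) + z).
  by have := le1 ((D + w c) * (n + 1) + c); lia.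
set s4 := upd _ _ _ _; set v := cell (s1 aTable) D z + g.
have eF i : s4 aTable i =
    if i == (D + w c) * (n + 1) + c then maxn (s1 aTable i) v else s1 aTable i.
  by rewrite /s4 !updE /= tab3; case: eqP => [->|].
have sz : sound D z (cell (s1 aTable) D z).-1 by case: h1 => h _ _; apply: h.
have sv : sound (D + w c) c v.-1.
  have -> : v.-1 = (cell (s1 aTable) D z).-1 + g.
    by rewrite /v -[in LHS](prednK p1) addSn.
  case: g1 => [->|[a [q1 q2 q3 q4 ->]]].
    exact: (sound_matched Rb Rirr Rtr hf q_f q_inj) sz hc p2.
  exact: (sound_starter Rb Rirr Rtr hf hfa q_f q_inj) sz q1 hc q2 p2 q3 q4.
have [g4 mono] := good_max h1 (ltnW hc) (leq_trans p1 (leq_addr _ _) : 0 < v) sv eF.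
have same i : i < D.+1 * (n + 1) -> s4 aTable i = s1 aTable i.
  move=> hi; rewrite eF ifF //; apply/eqP => ei; move: hi; rewrite ei ltnNge.
  by rewrite (leq_trans _ (leq_addr _ _)) // leq_mul2r -[D.+1]addn1 leq_add2l w0 orbT.
split=> //.
- by move=> i; apply: leq_trans (h2 i) (mono i).
- by move=> i hi; rewrite same ?h3.
- move=> t; rewrite ltnS leq_eqVlt => /orP[/eqP ->|ht]; last first.
    exact: closed_matched_mono (z_lt t ht) same mono (h4 t ht).
  rewrite -/z -/c => _ _.
  have e1 : cell (s4 aTable) D z = cell (s1 aTable) D z by rewrite /cell same // entry_lt.
  have e2 : v <= cell (s4 aTable) (D + w c) c by rewrite /cell eF eqxx leq_maxr.
  rewrite e1; split; first by apply: leq_trans e2; rewrite leq_add2l.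
  by move=> a q1 q2 q3 q4; apply: leq_trans e2; rewrite leq_add2l g3.
Qed.

Definition row_inv D F : Prop :=
  good F /\ forall D', D' < D ->
    (forall z a, z < n -> a < n -> closed_follower F D' z a) /\
    (forall z c, z <= n -> c < n -> closed_matched F D' z c).

Definition row_cost := (n * 3).+1 + ((n * (n * 3 + 5).+1).+1 +
  ((n * n * 5).+1 + ((n + 1) * n * (n * 3 + 7)).+1)).

Lemma row_prog_wp D s : env s -> s cD 0 = D -> D < 3 ^ m -> row_inv D (s aTable) ->
  wp row_prog row_cost (fun s' => row_inv D.+1 (s' aTable)) s.
Proof.
move=> es cDs hD [hg hrow].
have env_frame s1 s2 : (forall j i, j \in [:: aRole; aWeight; aStart;
  aPow] -> s2 j i = s1 j i) ->
    env s1 -> env s2.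
  move=> e [e1 e2 e3 e4]; split=> [y hy|y hy|y hy my|]; rewrite e //.
  - exact: e1. - exact: e2. - exact: e3.
rewrite /row_prog /row_cost; apply: (wp_seq (row_digits_wp es)) => s1 fr1 h1;
  rewrite cDs in h1.
have es1 : env s1 by apply: env_frame es => j i; rewrite !inE => /or4P[] /eqP ->;
  apply: fr1.
have c1 : s1 cD 0 = D by rewrite fr1.
apply: (wp_seq (row_flags_wp es1 c1 h1)) => s2 fr2 h2.
have es2 : env s2 by apply: env_frame es1 => j i; rewrite !inE => /or4P[] /eqP ->;
  apply: fr2.
have c2 : s2 cD 0 = D by rewrite fr2.
have t2 i : s2 aTable i = s aTable i by rewrite fr2 // fr1.
have g2 : good (s2 aTable) by apply: good_ext hg.
have av2 y : y < n -> s2 aAvail y = avail D y :> nat by move=> /h2[].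
have ad2 y : y < n -> s2 aAddable y = addable D y :> nat by move=> /h2[].
apply: (wp_seq (row_followers_wp es2 c2 hD av2 g2)) => s3 fr3 [g3 m3 a3 cf3].
have es3 : env s3 by apply: env_frame es2 => j i; rewrite !inE => /or4P[] /eqP ->;
  apply: fr3.
have c3 : s3 cD 0 = D by rewrite fr3.
have av3 y : y < n -> s3 aAvail y = avail D y :> nat by move=> hy; rewrite fr3 // av2.
have ad3 y : y < n -> s3 aAddable y = addable D y :> nat by move=> hy; rewrite fr3 // ad2.
apply: (wp_weaken (row_matched_wp es3 c3 hD av3 ad3 g3) (leqnn _)) => s4 fr4 [g4 m4 a4 cm4].
split=> // D'; rewrite ltnS leq_eqVlt => /orP[/eqP ->|hD'].
  split=> // z a hz ha; exact: closed_follower_mono (ltnW hz) a4 m4 (cf3 z a hz ha).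
have [h3 h4] := hrow D' hD'.
have le i : s aTable i <= s4 aTable i by rewrite -t2; apply: leq_trans (m3 i) (m4 i).
have eq i : i < D'.+1 * (n + 1) -> s4 aTable i = s aTable i.
  move=> hi; have hi' : i < D * (n + 1) by apply: leq_trans hi _;
    rewrite leq_mul2r hD' orbT.
  by rewrite a4 ?a3 ?t2 //; apply: leq_trans hi' _; rewrite leq_mul2r leqnSn orbT.
split=> [z a hz ha|z c hz hc].
  exact: closed_follower_mono (ltnW hz) eq le (h3 z a hz ha).
exact: closed_matched_mono hz eq le (h4 z c hz hc).
Qed.

End Rows.

(** * Rounds over the candidate sets *)

Section Rounds.

Variables (n : nat) (R : rel nat) (b : nat).
Hypothesis Rb : forall x y, R x y -> (x < n) && (y < n).
Hypothesis Rirr : irreflexive R.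
Hypothesis Rtr : transitive R.
Hypothesis bn : 3 * n + 8 <= b.

Local Notation wp := (wp n R b).

Variable f : nat -> nat.
Hypothesis hf : matching n R f.
Hypothesis hfa : unaugmentable n R f.

Local Notation q := (pair_index n R f).
Local Notation m := (size (lowers n R f)).
Local Notation w := (weight f q).
Local Notation digit := (digit f q).
Local Notation inside := (inside R f q).
Local Notation avail := (avail n R f q).
Local Notation addable := (addable n R f q).

Let small x : x <= n + 4 -> x < 2 ^ b. Proof. exact: b_small. Qed.

Let q_f x : x < n -> q (f x) = q x.
Proof. exact: pair_index_f. Qed.

Let q_inj x y : x < n -> y < n -> matched f x -> matched f y ->
  q x = q y -> y = x \/ y = f x.
Proof. exact: pair_index_inj. Qed.

Lemma pow3_bound : 3 ^ m <= 2 ^ n.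
Proof. exact: (pow3_pairs Rirr Rtr hf (leqnn m)). Qed.

Lemma table_prog_wp T s : env n R f T s -> (forall i, s aTable i <= n + 1) ->
  wp table_prog ((3 ^ m * (n + 1) * 2).+1 + (3 ^ m * (row_cost n).+1).+2)
    (fun s' => row_inv n R f T (3 ^ m) (s' aTable)) s.
Proof.
move=> es hs; have [er ew et ep] := es.
have p3 := pow3_bound.
pose I k (s' : state) := (forall i, s' aTable i <= n + 1) /\
  forall i, i < k -> s' aTable i = 0.
apply: (@wp_seq _ _ _ _ _ _ _ (I (3 ^ m * (n + 1)))).
  apply: wp_for => //=.
  - by rewrite ep.
  - by apply: (b_exp bn); apply: leq_mul => //; lia.
  move=> k s1 hk ck fr [h1 h2]; apply: wp_set; rewrite /= ?ck; first by apply: small; lia.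
  split=> i; rewrite !updE /=; first by case: ifP => // _; exact: h1.
  by rewrite ltnS leq_eqVlt; case: eqP => // _; exact: h2.
move=> s1 fr1 [h1 h2].
apply: wp_set_seq; rewrite /=; first by apply: small; lia.
set s2 := upd _ _ _ _.
have es2 : env n R f T s2.
  split=> [y hy|y hy|y hy my|]; rewrite /s2 !updE /= fr1 //.
  - exact: er. - exact: ew. - exact: et.
have t2 i : s2 aTable i = if i == n then 1 else s1 aTable i by [].
apply: (wp_for (I := fun D s' => row_inv n R f T D (s' aTable))) => //=.
- by case: es2.
- by apply: (b_exp bn); apply: leq_trans p3 (leq_pmulr _ _); rewrite addn2.
- split=> //; split.
  + move=> D z hD hz; rewrite /cell t2.
    case: eqP => [e _|_].
      have [|-> ->] := @entry_inj n D z 0 n hz (leqnn _); first by rewrite mul0n.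
      exact: (sound0 Rirr hf).
    rewrite h2 //; apply: leq_trans (entry_lt D hz) _.
    by rewrite leq_mul2r hD orbT.
  + by rewrite /cell t2 mul0n eqxx.
  + by move=> i; rewrite t2; case: ifP => [_|_]; [lia|exact: h1].
move=> D s3 hD cD3 fr3 hr; apply: row_prog_wp => //.
case: es2 => e1 e2 e3 e4.
by split=> [y hy|y hy|y hy my|]; rewrite fr3 //; [exact: e1|exact: e2|exact: e3].
Qed.

Definition best_ok v : Prop :=
  v <= n + 1 /\ exists s, [/\ perm_eq s (iota 0 n), lin n R s & v <= (bonds n R s).+1].

Definition compatible (T : pred nat) (s : seq nat) : Prop :=
  forall a, a < n -> ~~ matched f a ->
    (starter n R s a -> T a) /\ (finisher n R s a -> ~~ T a).

(** A single round answers only for the extensions whose starters and finishers agree with its T;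
    all rounds together answer for every extension. *)
Definition beats (T : pred nat) v : Prop :=
  forall s, perm_eq s (iota 0 n) -> lin n R s -> compatible T s -> bonds n R s < v.

Lemma row_inv_beats T F v : row_inv n R f T (3 ^ m) F ->
  (forall z, z <= n -> cell n F (3 ^ m).-1 z <= v) -> beats T v.
Proof.
move=> [[g1 g2 g3] hrow] hv s ps ls hc.
have [z hz h] : exists2 z, z <= n & bonds n R s < cell n F (3 ^ m).-1 z.
  apply: (table_complete Rb Rirr hf hfa (q_f) (q_inj) _ ps ls (T := T)) => //.
  - exact: sum_weight_pairs.
  - by move=> a ha ma; case: (hc a ha ma).
  - by move=> a ha ma; case: (hc a ha ma).
  - by move=> D z a hD hz ha; have [h _] := hrow D hD; exact: h.
  - by move=> D z c hD hz hc' p1 p2; have [_ h] := hrow D hD; case: (h z c hz hc' p1 p2).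
  - move=> D z a c hD hz ha hc' p1 p2 p3 p4 p5; have [_ h] := hrow D hD.
    by case: (h z c hz hc' p1 p3) => _; apply.
exact: leq_trans h (hv z hz).
Qed.

(* The mask lists the starters for [c = 0], the finishers for [c = 1]. *)
Definition marked mk c : pred nat := fun x => (mk %/ 2 ^ x + c) %% 2 == 1.

Definition consts (s : state) : Prop :=
  [/\ forall y, y < n -> s aRole y = role R f y,
      forall y, y < n -> s aWeight y = w y & s aPow 0 = 3 ^ m].

Definition round_cost := (1 + ((n * 3).+1 +
  (((3 ^ m * (n + 1) * 2).+1 + (3 ^ m * (row_cost n).+1).+2) + ((n + 1) * 2).+1))).

Lemma round_prog_wp s k c : consts s -> s cK 0 = k -> s cC 0 = c -> c < 2 ->
  s aMask k < 2 ^ n -> (forall i, s aTable i <= n + 1) -> best_ok (s aBest 0) ->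
  wp round_prog round_cost
    (fun s' => [/\ forall i, s' aTable i <= n + 1, s aBest 0 <= s' aBest 0,
       best_ok (s' aBest 0) & beats (marked (s aMask k) c) (s' aBest 0)]) s.
Proof.
move=> [er ew ep] ck cc c2 hmk ht hb; set mk := s aMask k in hmk *.
have mkb x : x <= mk -> x < 2 ^ b.
  move=> h; apply: (b_exp bn); apply: leq_trans (leq_pmulr _ _); rewrite ?addn2 //.
  exact: leq_trans h (ltnW hmk).
set T := marked mk c.
rewrite /round_cost add1n.
apply: wp_set_seq; rewrite /= ck -/mk; first exact: mkb.
set s1 := upd _ _ _ _.
pose I x (s' : state) := s' aRest 0 = mk %/ 2 ^ x /\ forall y, y < x -> s' aStart y = T y :> nat.
apply: (@wp_seq _ _ _ _ _ _ _ (I n)).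
  apply: wp_for => //; first by apply: small; lia.
    by split=> //; rewrite divn1.
  move=> x s2 hx cx fr2 [h1 h2].
  have cc2 : s2 cC 0 = c by rewrite (fr2 cC).
  have e : (mk %/ 2 ^ x + c) %% 2 = T x.
    by rewrite /T /marked;
      case: (_ %% 2) (ltn_pmod (mk %/ 2 ^ x + c) (isT : 0 < 2)) => [|[|]].
  apply: wp_set_seq; rewrite /= ?updE /= h1 cc2 ?cx e; first by apply: small;
    case: (T x); lia.
  apply: wp_set; rewrite /= ?updE /= h1 -divnMA -expnSr.
    by apply: mkb; apply: leq_div.
  split; first by rewrite updE.
  move=> y; rewrite ltnS leq_eqVlt !updE /=; case: eqP => [-> _ //|_]; exact: h2.
move=> s2 fr2 [_ h2].
have es2 : env n R f T s2.
  split=> [y hy|y hy|y hy my|].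
  - by rewrite fr2 // /s1 updE /= er.
  - by rewrite fr2 // /s1 updE /= ew.
  - exact: h2.
  - by rewrite fr2 // /s1 updE /= ep.
have ht2 i : s2 aTable i <= n + 1 by rewrite fr2 // ht.
apply: (wp_seq (table_prog_wp es2 ht2)) => s3 fr3 h3.
have b3 : s3 aBest 0 = s aBest 0 by rewrite fr3 // fr2 // /s1 updE.
have p3 : s3 aPow 0 = 3 ^ m by rewrite fr3 // fr2 // /s1 updE /= ep.
have [[g1 g2 g3] _] := h3.
pose J x (s' : state) := [/\ s aBest 0 <= s' aBest 0, best_ok (s' aBest 0) &
   forall z, z < x -> cell n (s3 aTable) (3 ^ m).-1 z <= s' aBest 0].
apply: (@wp_weaken _ _ _ _ _ _ (J (n + 1)) _ _ _ (leqnn _)); last first.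
  move=> s4 fr4 [h4 h5 h6]; split=> //; first by move=> i; rewrite fr4.
  by apply: row_inv_beats h3 _ => z hz; apply: h6; rewrite addn1.
apply: wp_for => //; first by apply: small; lia.
  by split; rewrite // b3.
move=> z s4 hz cz fr4 [h4 h5 h6].
have t4 i : s4 aTable i = s3 aTable i by rewrite (fr4 aTable).
have p4 : s4 aPow 0 = 3 ^ m by rewrite (fr4 aPow).
have bb : s4 aBest 0 <= n + 1 by case: h5.
apply: wp_set; rewrite /= ?updE /= p4 cz t4 subn1 -/(cell n (s3 aTable) (3 ^ m).-1 z).
  by apply: small; rewrite geq_max; have := g3 ((3 ^ m).-1 * (n + 1) + z);
    rewrite -/(cell n _ _ _); lia.
set v := maxn _ _; split; rewrite updE /=.
- exact: leq_trans h4 (leq_maxl _ _).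
- rewrite /v /maxn; case: (ltnP (s4 aBest 0) _) => // lt; split; first exact: g3.
  have zn : z <= n by move: hz; rewrite addn1.
  have l3 : (3 ^ m).-1 < 3 ^ m by rewrite prednK // expn_gt0.
  have p : 0 < cell n (s3 aTable) (3 ^ m).-1 z by apply: leq_ltn_trans lt.
  have [s' [a1 a2 a3]] := sound_full Rb Rirr Rtr (g1 _ _ l3 zn p).
  by exists s'; split=> //; rewrite -(prednK p) ltnS.
- move=> z'; rewrite ltnS leq_eqVlt => /orP[/eqP ->|hz']; first exact: leq_maxr.
  exact: leq_trans (h6 z' hz') (leq_maxl _ _).
Qed.

Local Notation subs := (subsets (predC (matched f)) m./2 n).

Lemma best_ok0 : best_ok 0.
Proof.
split=> //; have [|s [ps ls _]] := @lin_complete n R Rb Rirr Rtr [::] => //.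
by exists s.
Qed.

Lemma main_prog_wp s : consts s -> stored s subs ->
  (forall i, s aTable i = 0) ->
  wp main_prog (size subs * (2 * round_cost.+1).+2).+2
    (fun s' => best_ok (s' aBest 0) /\
       forall p c, p \in subs -> c < 2 -> beats (marked p.1 c) (s' aBest 0)) s.
Proof.
move=> [er ew ep] [hl hs] ht.
have LE : size subs <= 2 ^ n by exact: size_subsets.
apply: wp_set_seq; first by apply: small; rewrite /=; lia.
set s1 := upd _ _ _ _.
pose I k (s' : state) := [/\ best_ok (s' aBest 0), forall i, s' aTable i <= n + 1 &
  forall k' c, k' < k -> c < 2 -> beats (marked (s aMask k') c) (s' aBest 0)].
apply: (@wp_weaken _ _ _ _ _ _ (I (size subs)) _ _ _ (leqnn _)); last first.
  move=> s2 _ [h1 _ h2]; split=> // p c ps c2.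
  have hi : index p subs < size subs by rewrite index_mem.
  have [e _] := hs _ hi; have := h2 _ c hi c2; rewrite e nth_index //.
apply: wp_for => //=.
- by apply: (b_exp bn); apply: leq_trans LE (leq_pmulr _ _); rewrite addn2.
- split=> //; first exact: best_ok0.
  by move=> i; rewrite /s1 updE /= ht.
move=> k s2 hk ck fr2 [h1 h2 h3].
pose J c (s' : state) := [/\ best_ok (s' aBest 0), forall i, s' aTable i <= n + 1,
  s2 aBest 0 <= s' aBest 0 &
  forall c', c' < c -> beats (marked (s aMask k) c') (s' aBest 0)].
apply: (@wp_weaken _ _ _ _ _ _ (J 2) _ _ _ (leqnn _)); last first.
  move=> s3 _ [g1 g2 g3 g4]; split=> // k' c;
    rewrite ltnS leq_eqVlt => /orP[/eqP ->|hk'] c2.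
    exact: g4.
  by move=> s' ps ls cs; apply: leq_trans (h3 k' c hk' c2 s' ps ls cs) g3.
apply: wp_for => //; first by apply: small; lia.
move=> c s3 c2 cc fr3 [g1 g2 g3 g4].
have fr j i : j \notin [:: aBest, cK, cC & writes round_prog] -> s3 j i = s j i.
  move=> hj; have nb : (j == aBest) = false.
    by apply: contraNF hj => /eqP ->; rewrite inE eqxx.
  have h2' : j \notin cK :: cC :: writes round_prog.
    by apply: contraNN hj => h; rewrite inE h orbT.
  have h3' : j \notin cC :: writes round_prog.
    by apply: contraNN h2' => h; rewrite inE h orbT.
  by rewrite fr3 // fr2 // /s1 updE nb.
have mk : s3 aMask k = s aMask k by rewrite fr.
have hmk : s aMask k < 2 ^ n.
  by have [-> _] := hs k hk; have [] := subsets_lt (mem_nth (0, 0) hk).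
have cs3 : consts s3.
  by split=> [y hy|y hy|]; rewrite fr //; [exact: er|exact: ew].
have ck3 : s3 cK 0 = k by rewrite fr3.
apply: (wp_weaken (round_prog_wp cs3 ck3 cc c2 _ g2 g1) (leqnn _)).
  by rewrite mk.
move=> s4 fr4 [k1 k2 k3 k4]; split=> //; first exact: leq_trans g3 k2.
move=> c'; rewrite ltnS leq_eqVlt => /orP[/eqP ->|hc']; first by rewrite -mk.
by move=> s' ps ls cs; apply: leq_trans (g4 c' hc' s' ps ls cs) k2.
Qed.

(** No point is both a starter and a finisher, so the starters and the complement of the finishers
    are both compatible choices of T. Whichever of the two kinds has at most m/2 elements has its
    mask on the list. *)
Lemma beaten_by_some s v : perm_eq s (iota 0 n) -> lin n R s ->
  (forall p c, p \in subs -> c < 2 -> beats (marked p.1 c) v) ->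
  bonds n R s < v.
Proof.
move=> ps ls hb.
pose S P := [pred a | [&& a < n, ~~ matched f a & P s a]].
have cS P : count (S P) (iota 0 n) = size [seq a <- iota 0 n | ~~ matched f a & P s a].
  rewrite size_filter; apply: eq_in_count => a; rewrite mem_iota add0n => /andP[_ ha].
  by rewrite /= ha.
have SU P x : S P x -> predC (matched f) x by case/and3P.
have := starters_finishers Rb Rirr Rtr hf hfa ps ls; rewrite -!cS => hle.
have bit (p : nat * nat) (Q : pred nat) a c : c < 2 ->
    (forall x, (p.1 %/ 2 ^ x) %% 2 = (x < n) && Q x :> nat) -> a < n ->
    marked p.1 c a = Q a (+) (c == 1).
  move=> c2 h ha; rewrite /marked -modnDml h ha /=.
  by case: (Q a); case: c c2 => [|[|]].
have [h|h] := leqP (count (S (starter n R)) (iota 0 n)) m./2.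
  have [p [pS _ pb]] := subsets_complete (SU (starter n R)) h.
  apply: (hb p 0 pS isT s ps ls) => a ha ma;
    rewrite (bit p _ a 0 isT pb ha) /= addbF ha ma /=.
  by split=> //; rewrite /starter /finisher => /andP[->]; rewrite andbF.
have h' : count (S (finisher n R)) (iota 0 n) <= m./2 by clear -h hle; lia.
have [p [pS _ pb]] := subsets_complete (SU (finisher n R)) h'.
apply: (hb p 1 pS isT s ps ls) => a ha ma;
  rewrite (bit p _ a 1 isT pb ha) /= addbT ha ma /=.
split=> [|->//]; rewrite /starter /finisher => /andP[_ /negbTE ->] //.
Qed.

End Rounds.

(** * Total number of steps *)

Lemma row_cost_le n : (row_cost n).+1 <= 19 * (n + 1) ^ 3.
Proof. rewrite /row_cost !expnS expn0 muln1; nia. Qed.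

(** The exponent 4 is due to the local search, with n + 1 sweeps over n^3 triples. A row takes a
    cubic number of steps, and there are two tables of p rows for each of the s masks. *)
Lemma total_cost_le (n s p : nat) : 0 < s -> 0 < p ->
  (n * 2).+1 + ((n + 1) * (n * n * n * 9).+2).+1 + (2 + (n * 8).+1 +
  (4 + (n * (s * 5).+4).+1 +
   (s * (2 * (1 + ((n * 3).+1 + (((p * (n + 1) * 2).+1 + (p * (row_cost n).+1).+2) + ((n + 1) * 2).+1))).+1).+2).+2))
  <= 400 * (n + 1) ^ 4 * (s * p).
Proof.
move=> s0 p0; have := row_cost_le n; move: (row_cost n) => r hr.
set N := n + 1; have N0 : 0 < N by rewrite /N addn1.
set M := N ^ 3 in hr *.
have NM : N <= M by rewrite /M -{1}[N]expn1 leq_pexp2l.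
have e4 : N ^ 4 = N * M by rewrite /M -expnS.
have M0 : 0 < M by apply: leq_trans NM.
have h1 : 1 + ((n * 3).+1 + (((p * N * 2).+1 + (p * r.+1).+2) + (N * 2).+1)) <= 31 * (p * M).
  have a1 : p * r.+1 <= 19 * (p * M) by nia.
  have a2 : p * N <= p * M by rewrite leq_mul2l NM orbT.
  have a3 : M <= p * M by rewrite leq_pmull.
  by rewrite /N in NM a2 *; lia.
set rc := 1 + _ in h1 *.
have h2 : (s * (2 * rc.+1).+2).+2 <= 68 * (s * (p * M)).
  have a1 : 0 < p * M by rewrite muln_gt0 p0.
  have a2 : s * (2 * rc.+1).+2 <= s * (66 * (p * M)) by rewrite leq_mul2l; lia.
  have a3 : 0 < s * (p * M) by rewrite muln_gt0 s0.
  by lia.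
have h3 : 4 + (n * (s * 5).+4).+1 <= 14 * (s * N).
  by rewrite /N; nia.
have h4 : (n * 2).+1 + (N * (n * n * n * 9).+2).+1 <= 16 * (N * M).
  have a1 : n * n * n <= M by rewrite /M !expnS expn0 muln1 mulnA !leq_mul // /N leq_addr.
  have a2 : N * (n * n * n * 9).+2 <= N * (11 * M) by rewrite leq_mul2l; lia.
  have a3 : N <= N * M by rewrite leq_pmulr.
  by rewrite /N in a2 a3 *; lia.
rewrite e4.
have b1 : N * M <= N * M * (s * p) by rewrite leq_pmulr // muln_gt0 s0.
have b2 : s * (p * M) <= N * M * (s * p).
  by rewrite mulnA [X in _ <= X]mulnC leq_mul // leq_pmull.
have b3 : s * N <= N * M * (s * p).
  rewrite [X in X <= _]mulnC; apply: leq_mul; first by rewrite leq_pmulr.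
  by rewrite leq_pmulr.
have b4 : N <= N * M by rewrite leq_pmulr.
by rewrite -mulnA; move: h2 h3 h4 b1 b2 b3 b4; rewrite /N; lia.
Qed.

Section Algorithm.

Variables (n : nat) (R : rel nat) (b : nat).
Hypothesis Rb : forall x y, R x y -> (x < n) && (y < n).
Hypothesis Rirr : irreflexive R.
Hypothesis Rtr : transitive R.
Hypothesis bn : 3 * n + 8 <= b.

(** U and m describe the matching that the search happens to find, so they come out of the run. The
    time bound will use only that 2m and the size of U add up to n. *)
Lemma jump_prog_wp (s : state) : (forall j i, s j i = 0) ->
  exists U m T, [/\ m.*2 + count U (iota 0 n) = n,
    T <= 400 * (n + 1) ^ 4 * (size (subsets U m./2 n) * 3 ^ m) &
    wp n R b jump_prog T (fun s' => best_ok n R (s' aBest 0) /\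
      forall s0, perm_eq s0 (iota 0 n) -> lin n R s0 -> bonds n R s0 < s' aBest 0) s].
Proof.
move=> s0; have w1 := match_prog_wp Rirr bn s.
have fr1 j i : j \notin writes match_prog -> prun n R match_prog s j i = 0.
  by move=> hj; rewrite prun_writes.
have [_ _ []] := w1; set s1 := prun n R match_prog s in fr1 *; set f := s1 aMate => hf hfa.
have r0 x : s1 aRole x = 0 by rewrite fr1.
have w0 x : s1 aWeight x = 0 by rewrite fr1.
have w2 := pairs_prog_wp Rirr Rtr bn hf (frefl f : s1 aMate =1 f) r0 w0.
pose m := size (lowers n R f); pose U := predC (matched f).
exists U, m.
have dl := double_lowers Rirr Rtr hf.
have w34 : wp n R b (PSeq subsets_prog main_prog)
   ((4 + (n * (size (subsets U m./2 n) * 5).+4).+1) +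
    (size (subsets U m./2 n) * (2 * (round_cost n R f).+1).+2).+2)
   (fun s' => best_ok n R (s' aBest 0) /\
      forall s0, perm_eq s0 (iota 0 n) -> lin n R s0 -> bonds n R s0 < s' aBest 0)
   (prun n R pairs_prog s1).
  have [_ _ [p1 p2 p3 p4]] := w2.
  set s2 := prun n R pairs_prog s1 in p1 p2 p3 p4 *.
  have fr2 j i : j \notin writes match_prog ++ writes pairs_prog -> s2 j i = 0.
    by rewrite mem_cat negb_or => /andP[h1 h2]; rewrite /s2 prun_writes // fr1.
  have mn : m <= n by move: dl; rewrite -/m; lia.
  have role0 x : x < n -> (s2 aRole x == 0) = U x.
    by move=> hx; rewrite p3 // -leqn0 leqNgt (role_gt0 Rirr hf hx).
  apply: (wp_seq (subsets_prog_wp R bn mn p2 role0)) => s3 fr3 h3.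
  have cs3 : consts n R f s3.
    by split=> [y hy|y hy|]; rewrite fr3 //; [exact: p3|exact: p4].
  apply: (wp_weaken (main_prog_wp Rb Rirr Rtr bn hf hfa cs3 h3 _) (leqnn _)).
    by move=> i; rewrite fr3 // fr2.
  move=> s4 _ [h4 h5]; split=> // s' ps ls.
  exact: (beaten_by_some Rb Rirr Rtr hf hfa ps ls h5).
have [a1 a2 _] := w1; have [b1 b2 _] := w2; have [c1 c2 c3] := w34.
eexists; split; last first.
- by split; [|exact: leq_add a2 (leq_add b2 c2)|].
- apply: total_cost_le; [exact: size_subsets_gt0|by rewrite expn_gt0].
- exact: dl.
Qed.

End Algorithm.

(** * The base 1.824 *)

Section Constant.

Import Order.TTheory GRing.Theory Num.Theory.
Local Open Scope ring_scope.

Lemma decimal_split : 1.824%Q = (1 + 821 / 1000) * (1824 / 1821) :> rat.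
Proof.
have -> : 1.824%Q = 228 / 125 :> rat by rewrite -[LHS]divq_num_den.
by lra.
Qed.

Lemma absorb_poly (c d : nat) (y r : rat) : 1 < r -> 0 <= y ->
  exists C : nat, forall n Z : nat, Z%:R <= y ^+ n :> rat ->
  (c * (n + 1) ^ d * Z)%:R <= C%:R * (y * r) ^+ n :> rat.
Proof.
(* This k exceeds 2^d / (r - 1), so that (2^d - 1) / k <= r - 1. *)
move=> r1 y0; pose k := (Num.bound (2 ^+ d / (r - 1))).+1.
have k0 : (0 < k)%N by [].
have kp : 0 < k%:R :> rat by rewrite ltr0n.
have k1 : k%:R^-1 <= 1 :> rat by rewrite invf_le1 // ler1n.
(* By convexity (1 + e)^i lies below its chord over the interval from 0 to 1. *)
have bern (e : rat) (i : nat) : 0 <= e <= 1 -> (1 + e) ^+ i <= 1 + (2 ^+ i - 1) * e.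
  case/andP=> e0 e1; elim: i => [|i ih]; first by rewrite !expr0 subrr mul0r addr0.
  have h2 : 1 <= 2 ^+ i :> rat by rewrite exprn_ege1 // ler1n.
  rewrite exprS; apply: le_trans (ler_wpM2l _ ih) _; first by rewrite addr_ge0.
  rewrite exprS; set u := 2 ^+ i in h2 *.
  have : 0 <= (u - 1) * e * (1 - e) by rewrite !mulr_ge0 // subr_ge0.
  by lra.
have hk : (1 + k%:R^-1) ^+ d <= r.
  apply: le_trans (bern _ d _) _; first by rewrite invr_ge0 k1 ltW.
  rewrite -lerBrDl ler_pdivrMr //.
  apply: le_trans (_ : 2 ^+ d <= _); first by rewrite lerBlDr lerDl.
  rewrite mulrC -ler_pdivrMr ?subr_gt0 //.
  apply: le_trans (ltW (archi_boundP _)) _.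
    by rewrite divr_ge0 ?exprn_ge0 // subr_ge0 ltW.
  by rewrite ler_nat.
exists (c * k ^ d)%N => n Z hZ; have hp := poly_le_exp n k0 hk.
rewrite exprMn !natrM !natrX addn1 -!mulrA ler_wpM2l ?ler0n //.
rewrite [y ^+ n * _]mulrC mulrA.
by apply: ler_pM; rewrite ?exprn_ge0.
Qed.

(* 1.824 / 1.821 > 1 absorbs the polynomial factor. *)
Lemma time_growth (c : nat) : exists C : nat, forall (n m : nat) (U : pred nat),
  (m.*2 + count U (iota 0 n))%N = n ->
  (c * (n + 1) ^ 5 * (size (subsets U m./2 n) * 3 ^ m))%:R
    <= C%:R * 1.824%Q ^+ n :> rat.
Proof.
have r1 : 1 < 1824 / 1821 :> rat by lra.
have y0 : 0 <= 1 + 821 / 1000 :> rat by lra.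
have z01 : 0 < (821 / 1000 : rat) <= 1 by lra.
(* The right side is about 9.03, so z = 0.821 is close to the smallest admissible value. *)
have z9 : 9 <= 821 / 1000 * (1 + 821 / 1000) ^+ 4 :> rat by lra.
have [C hC] := absorb_poly c 5 r1 y0.
exists C => n m U e; rewrite decimal_split.
exact: hC (states_bound z01 z9 e).
Qed.

End Constant.

(** The last command is written for the machine directly, since it replaces the input size in cell
    0, which lies outside all arrays. *)
Definition main_cmd : cmd :=
  Seq (compile jump_prog)
      (Write (Const 0) (Minus (Get (Const 0)) (Get (caddr aBest (Const 0))))).

Lemma encode_sim (X : finType) (lt : rel X) b : 3 * #|X| + 8 <= b ->
  sim #|X| (natrel lt) b (encode lt) (fun _ _ => 0).
Proof.
move=> hb; have [nb b0] : #|X| <= b /\ 0 < b by move: #|X| hb => k hb; split; lia.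
have p1 : 1 < 2 ^ b by rewrite -{1}(expn0 2) ltn_exp2l.
have sz : size [seq nat_of_bool (lt x y) | x <- enum X, y <- enum X] = #|X| * #|X|.
  by rewrite size_allpairs -cardE.
split=> //.
- by move=> x y hx hy; apply: encode_rel.
- move=> j i _; rewrite addn1 addSn /=; apply: nth_default.
  by rewrite sz leq_addr.
- case=> [|a] /=.
    by apply: leq_trans (ltn_expl _ (isT : 1 < 2)) _; rewrite leq_exp2l.
  set l := [seq _ | x <- _, y <- _] in sz *.
  have [ha|ha] := ltnP a (size l); last by rewrite nth_default // ltnW.
  have /allpairsP[[x y] [_ _ ->]] := mem_nth 0 ha.
  by case: (lt _ _); rewrite // ltnW.
Qed.

(** The word length b is at most 11 (n + 1), whence 4400 = 11 * 400 and the exponent 5 instead of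
    4. *)
Lemma main_cost_le (n p w b T Z t1 t2 : nat) :
  b <= 11 * (n + 1) -> 0 < Z -> T <= 400 * (n + 1) ^ 4 * Z ->
  t1 <= b * p * T -> t2 <= b * w ->
  t1 + t2 <= (p + w) * 4400 * (n + 1) ^ 5 * Z.
Proof.
move=> hb Z0 hT h1 h2; set N := n + 1 in hb hT *.
have N0 : 0 < N by rewrite /N addn1.
have e5 : N ^ 5 = N * N ^ 4 by rewrite -expnS.
have M0 : 0 < N ^ 4 by rewrite expn_gt0 N0.
move: (N ^ 4) e5 hT M0 => M -> hT M0.
have a1 : b * p * T <= 11 * N * p * (400 * M * Z).
  by apply: leq_mul hT; rewrite leq_mul2r hb orbT.
have a2 : b * w <= 11 * N * w * (400 * M * Z).
  apply: leq_trans (_ : 11 * N * w <= _); first by rewrite leq_mul2r hb orbT.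
  by rewrite leq_pmulr // !muln_gt0 M0.
have -> : (p + w) * 4400 * (N * M) * Z = 11 * N * p * (400 * M * Z) + 11 * N * w * (400 * M * Z).
  by ring.
by apply: leq_add; [apply: leq_trans h1 a1|apply: leq_trans h2 a2].
Qed.

Theorem theorem2 :
  exists (c : cmd) (C : nat),
    forall (n : nat) (X : finType) (lt : rel X),
      strict_order lt -> #|X| = n ->
      exists (t : nat) (m : memory),
        [/\ exec c (encode lt) t m,
            is_jump_number lt (m 0) &
            (t%:R <= C%:R * 1.824%Q ^+ n :> rat)%R].
Proof.
pose e := Minus (Get (Const 0)) (Get (caddr aBest (Const 0))).
pose ws := wsize (Const 0) e.
have [C hC] := time_growth ((psize jump_prog + ws) * 4400).
exists main_cmd, C => n X lt hlt hn; rewrite -{n}hn; set n := #|X|.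
set b := 3 * n + 8.
have Rb := natrel_bound (lt := lt); have Rirr := natrel_irr hlt.
have Rtr := natrel_trans hlt.
have hs := encode_sim lt (leqnn b).
have [U [m [T [eU hT [w1 w2 [[bb [s1 [ps1 ls1 hs1]]] w4]]]]]] :=
  jump_prog_wp Rb Rirr Rtr (leqnn b) (s := fun _ _ => 0) (fun _ _ => erefl).
have b0 : 0 < b by rewrite /b addn_gt0 orbT.
have [t1 [m1 [ex1 ht1 [m0 _ mc mb]]]] := compile_exec Rb b0 jump_prog_wf hs w1.
set s := prun _ _ _ _ in w4 hs1 mc.
have ee : eval m1 e = n - s aBest 0.
  by rewrite /= m0 -(mc aBest 0 isT).
eexists; eexists; split.
- exact: ExecSeq ex1 (ExecWrite _ _ _).
- rewrite /update eqxx -/e ee.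
  by apply: (is_jump_number_best hlt ps1 ls1 hs1) => s' ps' ls'; apply: w4.
have hw := write_cost_le b0 mb (Const 0) e; rewrite -/ws in hw.
apply: Order.POrderTheory.le_trans (hC n m U eU); rewrite Num.Theory.ler_nat.
apply: main_cost_le (leq_trans w2 hT) ht1 hw;
  last by rewrite muln_gt0 size_subsets_gt0 expn_gt0.
by rewrite /b; lia.
Qed.
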